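(* Let $\{Z_n\}_{n\in\mathbb{N}_0}$ be a defective Galton-Watson process in a varying environment $v=\{f_n\}_{n\in\mathbb{N}}$. There exists a random variable $Z_\infty$ with values in $\mathbb{N}_0\cup\{\Delta\}\cup\{\infty\}$ such that, as $n\to\infty$, $$Z_n\to Z_\infty\quad\text{a.s.}$$ Moreover, $$P[0<Z_\infty<\infty]>0\qquad\Longleftrightarrow\qquad \sum_{n=1}^\infty (1-f_n[1])<\infty .$$
   Context: $\mathbb{N}=\{1,2,\dots\}$, $\mathbb{N}_0=\mathbb{N}\cup\{0\}$, $\Delta\notin\mathbb{N}_0$ is an extra ''graveyard'' state, and $\mathbb{N}_\Delta=\mathbb{N}_0\cup\{\Delta\}$. For each $n\in\mathbb{N}$, $f_n$ is a possibly defective distribution on $\mathbb{N}_0$: weights $f_n[k]\ge 0$, $k\in\mathbb{N}_0$, with $\sum_k f_n[k]\le 1$; its generating function is also denoted $f_n(s)=\sum_{k\ge0}f_n[k]s^k$, $s\in[0,1]$. Standing assumption: $0<f_n'(1)<\infty$ for all $n\ge1$ (where $f_n'(1)=\sum_k k f_n[k]$). A defective Galton-Watson process in a varying environment $v=\{f_n\}_{n\in\mathbb{N}}$ is the process defined by $Z_0=1$, $Z_n=\sum_{j=1}^{Z_{n-1}}X_{nj}$, $n\in\mathbb{N}$, where $\{X_{nj}:n,j\in\mathbb{N}\}$ are independent $\mathbb{N}_\Delta$-valued random variables with $P[X_{nj}=k]=f_n[k]$ for $k\in\mathbb{N}_0$ and $P[X_{nj}=\Delta]=1-f_n(1)$.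 Conventions: $\Delta+k=\Delta$ for $k\in\mathbb{N}_\Delta$, and $\sum_{j=1}^{\Delta}k_j=\Delta$; empty sums are $0$. Thus $0$ and $\Delta$ are absorbing. Convergence in $\mathbb{N}_\Delta\cup\{\infty\}$: convergence to an element of $\mathbb{N}_\Delta$ means being eventually equal to it (so $\Delta$ is an isolated point), convergence to $\infty$ means divergence to $+\infty$ in $\mathbb{N}_0$ in the usual sense. The event $\{0<Z_\infty<\infty\}$ means $Z_\infty\in\mathbb{N}$ (in particular $Z_\infty\ne\Delta$). *)

(* Defs.v *)
From HB Require Import structures.
From mathcomp Require Import all_boot all_order all_algebra finmap.
From mathcomp Require Import all_classical all_reals all_analysis.

Set Implicit Arguments.
Unset Strict Implicit.
Unset Printing Implicit Defensive.

Import Order.TTheory GRing.Theory Num.Theory.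

Local Open Scope classical_set_scope.
Local Open Scope ring_scope.
Local Open Scope ereal_scope.

(* [Some k] is the natural number k and [None] is the graveyard state. *)
Definition NDelta : Type := option nat.
Definition fin_state (k : nat) : NDelta := Some k.
Definition graveyard : NDelta := None.

HB.instance Definition _ := Countable.on NDelta.
HB.instance Definition _ := Pointed.on NDelta.
HB.instance Definition _ := @isMeasurable.Build default_measure_display
  NDelta (@discrete_measurable NDelta) (@discrete_measurable0 NDelta)
  (@discrete_measurableC NDelta) (@discrete_measurableU NDelta).

(* [Some a] is the state a of [NDelta] and [None] is the point at infinity.  The
   space is countable, so its Borel sigma-algebra is the discrete one. *)
Definition NDeltaInf : Type := option NDelta.
Definition at_state (a : NDelta) : NDeltaInf := Some a.
Definition at_infty : NDeltaInf := None.

HB.instance Definition _ := Countable.on NDeltaInf.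
HB.instance Definition _ := Pointed.on NDeltaInf.
HB.instance Definition _ := @isMeasurable.Build default_measure_display
  NDeltaInf (@discrete_measurable NDeltaInf) (@discrete_measurable0 NDeltaInf)
  (@discrete_measurableC NDeltaInf) (@discrete_measurableU NDeltaInf).

Definition cvg_NDelta (z : nat -> NDelta) (l : NDeltaInf) : Prop :=
  match l with
  | Some a => \forall n \near \oo, z n = a
  | None => forall M : nat,
      \forall n \near \oo, exists2 k, z n = fin_state k & (M <= k)%N
  end.

Definition addD (x y : NDelta) : NDelta :=
  match x, y with
  | Some a, Some b => fin_state (a + b)
  | _, _ => graveyard
  end.

Definition sumD (z : NDelta) (x : nat -> NDelta) : NDelta :=
  match z with
  | Some m => \big[addD/fin_state 0]_(1 <= j < m.+1) x j
  | None => graveyard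
  end.

Section distributions.
Context {R : realType}.
Implicit Type f : nat -> R.

Definition defective_distribution f : Prop :=
  (forall k, (0 <= f k)%R) /\ \sum_(0 <= k <oo) (f k)%:E <= 1.

Definition genfun f (s : R) : \bar R := \sum_(0 <= k <oo) (f k * s ^+ k)%:E.

(* The left derivative of [genfun f] at 1, as an extended real. *)
Definition dgenfun1 f : \bar R := \sum_(0 <= k <oo) (k%:R * f k)%:E.

End distributions.

Section random_variables.
Context {R : realType} {d : measure_display} {T : measurableType d}.
Context {P : probability T R}.

Definition has_law (X : {RV P >-> NDelta}) (f : nat -> R) : Prop :=
  (forall k, P (X @^-1` [set fin_state k]) = (f k)%:E) /\
  P (X @^-1` [set graveyard]) = 1 - genfun f 1.

Definition mutually_independent {d' : measure_display} {E : measurableType d'}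
    {I : choiceType} (D : set I) (X : I -> {RV P >-> E}) : Prop :=
  forall (J : {fset I}) (A : I -> set E),
    [set` J] `<=` D -> (forall i, measurable (A i)) ->
    P (\bigcap_(i in [set` J]) (X i @^-1` A i)) =
    \prod_(i <- J) P (X i @^-1` A i).

(* Only the [X n j] with n, j >= 1 are used. *)
Fixpoint gw_process (X : nat -> nat -> {RV P >-> NDelta}) (n : nat) (w : T)
    : NDelta :=
  match n with
  | 0%N => fin_state 1
  | m.+1 => sumD (gw_process X m w) (fun j => X m.+1 j w)
  end.

End random_variables.

(* Main.v *)
(** Let [g_n] be the generating function of generation [n] (the graveyard counting
    as 0), and suppose that state [k >= 1] is visited infinitely often with positive
    probability.  By the first-visit decomposition there are a time [m] and an event
    [H] of the past on which [Z_m = k] and given which [k] is revisited infinitely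
    often with probability close to 1.  For a far horizon [N] put
    [q_n = (g_(n+1) o ... o g_N)(0)].  By convexity [((1 + q_n) / 2) ^ Z_n] is a
    supermartingale that is at least [2 ^ - k] at every visit to [k], so optional
    stopping on [H] gives [F (1/2 + q/2) >= (1 - delta) / 2] and [F q <= delta] for
    each composition [F = g_(m+1) o ... o g_M] and [q = q_M].  Since
    [((1 + q) / 2) ^ j - q ^ j <= 2 / 5 < 1 / 2] for [j >= 2], this forces the
    coefficient of [s] in [F] to be at least 17/20, uniformly in [M].
    Following the orbits of 1/8 and 0 under the [g_n], whose distance shrinks at each
    step by a factor at most [1 - (1 - f_n[1]) / 3] while it stays bounded below, one
    gets [\sum_n (1 - f_n[1]) < oo].  So if this series diverges, no [k >= 1] is
    visited infinitely often and [Z] tends to 0, [Delta] or infinity.  If it converges,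
    Borel-Cantelli shows that every fixed set of individuals eventually has exactly one
    child each, which gives convergence, and a union bound after a late time gives a
    positive probability of staying in a state [k >= 1]. *)

Require Import Defs.
From HB Require Import structures.
From mathcomp Require Import all_boot all_order all_algebra finmap.
From mathcomp Require Import all_classical all_reals all_analysis.
From mathcomp Require Import measurable_realfun ring lra zify.

Set Implicit Arguments.
Unset Strict Implicit.
Unset Printing Implicit Defensive.

Import Order.TTheory GRing.Theory Num.Theory.

Local Open Scope classical_set_scope.
Local Open Scope ring_scope.
Local Open Scope ereal_scope.

(** * Independence from the past *)

Section cylinders.
Context {R : realType} {d d' : measure_display} {T : measurableType d}
  {E : measurableType d'} {P : probability T R} {I : choiceType}.
Context (X : I -> {RV P >-> E}).
Implicit Types (D : set I) (A : set T) (B : set E).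

(** The pi-system that generates [history D], in the form to which [mutually_independent]
    applies. *)
Definition cylinder D : set_system T :=
  [set A | exists J : {fset I}, exists B : I -> set E,
     [/\ [set` J] `<=` D, forall i, measurable (B i) &
         A = \bigcap_(i in [set` J]) (X i @^-1` B i)]].

Definition history D : set_system T := <<s cylinder D >>.

Lemma measurable_RV_preimage i B : measurable B -> measurable (X i @^-1` B).
Proof. by move=> mB; rewrite -[_ @^-1` _]setTI; exact: measurable_funPT. Qed.

Lemma cylinder_setI_closed D : setI_closed (cylinder D).
Proof.
move=> _ _ [J [B [JD mB ->]]] [K [C [KD mC ->]]].
(* Padding by [setT] lets both families of constraints be indexed by the union of [J] and [K]. *)
exists (J `|` K)%fset, (fun i => (if i \in J then B i else setT) `&`
                               (if i \in K then C i else setT)); split.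
- by move=> i /=; rewrite inE => /orP[/JD|/KD].
- by move=> i; apply: measurableI; case: ifP.
- apply/seteqP; split => [w [wJ wK] i /=|w wJK].
    rewrite inE; split; case: ifP => //; [by move/wJ|by move/wK].
  split=> i /= iJ; have /= := wJK i; rewrite inE iJ ?orbT/= => /(_ isT)[] //.
Qed.

Lemma history_sigma_algebra D : sigma_algebra setT (history D).
Proof. exact: smallest_sigma_algebra. Qed.

Lemma cylinder_measurable D : cylinder D `<=` measurable.
Proof.
move=> _ [J [B [_ mB ->]]]; rewrite bigcap_fset.
by apply: bigsetI_measurable => i _; exact: measurable_RV_preimage.
Qed.

Lemma history_measurable D : history D `<=` measurable.
Proof.
apply: smallest_sub; last exact: cylinder_measurable.
split => //; [by move=> A mA; rewrite setTD; exact: measurableC|].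
by move=> F mF; exact: bigcupT_measurable.
Qed.

Lemma history_preimage D i B : D i -> measurable B -> history D (X i @^-1` B).
Proof.
move=> Di mB; apply: sub_gen_smallest; exists [fset i]%fset, (fun=> B).
split => //; first by move=> j /=; rewrite inE => /eqP ->.
by rewrite set_fset1 bigcap_set1.
Qed.

Lemma history_subset D D' : D `<=` D' -> history D `<=` history D'.
Proof.
move=> DD'; apply: smallest_sub; first exact: history_sigma_algebra.
move=> A [J [B [JD mB ->]]].
by apply: sub_gen_smallest; exists J, B; split => // i /JD /DD'.
Qed.

Lemma history_setT D : history D setT.
Proof.
by case: (history_sigma_algebra D) => h0 /(_ _ h0) + _; rewrite setTD setC0.
Qed.

Lemma history_set0 D : history D set0.
Proof. by case: (history_sigma_algebra D). Qed.

Lemma history_setC D A : history D A -> history D (~` A).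
Proof.
by case: (history_sigma_algebra D) => _ + _ => /[apply]; rewrite setTD.
Qed.

Lemma history_bigcup D (F : nat -> set T) :
  (forall n, history D (F n)) -> history D (\bigcup_n F n).
Proof. by case: (history_sigma_algebra D) => _ _; exact. Qed.

Lemma history_bigcap D (F : nat -> set T) :
  (forall n, history D (F n)) -> history D (\bigcap_n F n).
Proof.
move=> hF; rewrite -[\bigcap__ _]setCK setC_bigcap; apply: history_setC.
by apply: history_bigcup => n; exact: history_setC.
Qed.

Lemma history_setU D A A' : history D A -> history D A' -> history D (A `|` A').
Proof.
move=> hA hA'; rewrite -bigcup2E; apply: history_bigcup => -[//|[//|n]].
exact: history_set0.
Qed.

Lemma history_setI D A A' : history D A -> history D A' -> history D (A `&` A').
Proof.
move=> hA hA'; rewrite -bigcap2E; apply: history_bigcap => -[//|[//|n]].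
exact: history_setT.
Qed.

Lemma history_setD D A A' : history D A -> history D A' -> history D (A `\` A').
Proof.
by move=> hA hA'; rewrite setDE; apply: history_setI => //; exact: history_setC.
Qed.

(** Pi-lambda argument: the events that factor against the given event on [X i] form a Dynkin
    system, which contains all cylinders over [D] because [i] lies outside [D]. *)
Lemma history_indep D0 D i A B : mutually_independent D0 X ->
  D `<=` D0 -> D0 i -> ~ D i -> history D A -> measurable B ->
  P (A `&` X i @^-1` B) = P A * P (X i @^-1` B).
Proof.
move=> indep DD0 D0i nDi hA mB.
have mXB := measurable_RV_preimage i mB.
suff: history D `<=` [set A | measurable A /\
    P (A `&` X i @^-1` B) = P A * P (X i @^-1` B)] by move=> /(_ _ hA)[].
rewrite /history -setI_closed_g_dynkin_g_sigma_algebra; last first.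
  exact: cylinder_setI_closed.
apply: smallest_sub.
- split => /=.
  + by rewrite setTI probability_setT mul1e.
  + move=> C [mC PC]; split; first exact: measurableC.
    transitivity (P (X i @^-1` B) - P (C `&` X i @^-1` B)).
      rewrite setIC -setDE [C `&` _]setIC; apply: measureD => //.
      by rewrite ltey_eq fin_num_measure.
    rewrite PC probability_setC// muleBl ?mul1e//.
      exact: fin_num_measure.
  + move=> F tF hF; have mF n : measurable (F n) by have [] := hF n.
    split; first exact: bigcupT_measurable.
    rewrite setI_bigcupl !measure_bigcup//=; last first.
      exact: trivIset_setIr.
      by move=> n _; exact: measurableI.
    under eq_eseriesr do rewrite (proj2 (hF _)).
    rewrite -(fineK (fin_num_measure P _ mXB)) muleC -nneseriesZl; last first.
      by move=> n _; exact: measure_ge0.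
    by apply: eq_eseriesr => n _; rewrite muleC.
- move=> C cC; split; first exact: cylinder_measurable cC.
  case: cC => J [C' [JD mC' ->]].
  have iJ : i \notin J by apply/negP => /JD.
  rewrite indep//; last exact: (subset_trans JD).
  (* A cylinder over [J] cut by the event on [X i] is again a cylinder, now over [J] and [i]. *)
  pose B' j := if j == i then B else C' j.
  have B'J j : j \in J -> B' j = C' j.
    by move=> jJ; rewrite /B'; case: eqP jJ iJ => // -> ->.
  have B'i : B' i = B by rewrite /B' eqxx.
  have -> : \bigcap_(j in [set` J]) (X j @^-1` C' j) `&` X i @^-1` B =
      \bigcap_(j in [set` (i |` J)%fset]) (X j @^-1` B' j).
    apply/seteqP; split => [w [wJ wi] j /=|w wJ].
      by rewrite !inE => /orP[/eqP ->|jJ]; rewrite ?B'i ?B'J//; exact: wJ.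
    split; last by rewrite -B'i; apply: wJ; rewrite /= !inE eqxx.
    by move=> j /= jJ; rewrite -B'J//; apply: wJ; rewrite /= !inE jJ orbT.
  rewrite indep; last 2 first.
  + by move=> j /=; rewrite !inE => /orP[/eqP ->//|/JD/DD0].
  + by move=> j; rewrite /B'; case: eqP.
  rewrite big_fsetU1//= B'i muleC; congr (_ * _).
  by apply: eq_big_seq => j jJ; rewrite B'J.
Qed.

End cylinders.

(** [G] is abstract so that the lemma serves measurable sets and histories alike; pickling
    enumerates the points of [B]. *)
Lemma preimage_countable (U : Type) (C : countType) (G : set_system U)
    (Y : U -> C) (B : set C) : G set0 ->
  (forall F : nat -> set U, (forall n, G (F n)) -> G (\bigcup_n F n)) ->
  (forall a, G (Y @^-1` [set a])) -> G (Y @^-1` B).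
Proof.
move=> G0 GU GY.
have -> : Y @^-1` B = \bigcup_n
    (if choice.unpickle n is Some a then Y @^-1` ([set a] `&` B) else set0).
  apply/seteqP; split => [w Bw|w [n _]].
    by exists (choice.pickle (Y w)) => //; rewrite choice.pickleK.
  by case: choice.unpickle => // a [/= ->].
apply: GU => n; case: choice.unpickle => // a.
have [Ba|nBa] := pselect (B a).
  rewrite (_ : _ `&` _ = [set a]); first exact: GY.
  by apply/seteqP; split => [_ [->]//|_ ->].
rewrite (_ : _ `&` _ = set0) ?preimage_set0//.
by rewrite -subset0 => _ [-> /nBa].
Qed.

(** * Defective generating functions *)

(* The graveyard contributes 0, as in the expansion of a defective generating function. *)
Definition pw {R : realType} (s : R) (z : NDelta) : R :=
  if z is Some j then (s ^+ j)%R else 0%R.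

Section pw.
Context {R : realType}.
Implicit Types (s t : R).
Local Open Scope ring_scope.

Lemma pw_ge0 s z : 0 <= s -> 0 <= pw s z.
Proof. by move=> s0; case: z => //= j; exact: exprn_ge0. Qed.

Lemma pw_le1 s z : 0 <= s <= 1 -> pw s z <= 1.
Proof. by move=> /andP[s0 s1]; case: z => //= j; exact: exprn_ile1. Qed.

Lemma pw_le s t z : 0 <= s -> s <= t -> pw s z <= pw t z.
Proof.
move=> s0 st; case: z => //= j.
by apply: lerXn2r; rewrite ?nnegrE// (le_trans s0).
Qed.

Lemma pw_addD s x y : pw s (addD x y) = pw s x * pw s y.
Proof. by case: x => [a|]; case: y => [b|] /=; rewrite ?mulr0 ?mul0r ?exprD. Qed.

Lemma pw_unit_le s z : 0 <= s <= 1 -> pw s z <= pw 0 z + s.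
Proof.
move=> /andP[s0 s1]; case: z => [[|j]|] /=; rewrite ?add0r//.
  by rewrite !expr0 lerDl.
by rewrite expr0n add0r exprS ler_piMr// exprn_ile1.
Qed.

(** Convexity of the power at the midpoint of [q] and 1. *)
Lemma expr_midpoint (q : R) j : 0 <= q <= 1 -> ((1 + q) / 2) ^+ j <= (1 + q ^+ j) / 2.
Proof.
move=> /andP[q0 q1]; elim: j => [|j IH]; first by rewrite !expr0; lra.
have qj1 : q ^+ j <= 1 by exact: exprn_ile1.
rewrite exprS; apply: (le_trans (ler_wpM2l _ IH)); first lra.
rewrite (exprS q); set a := q ^+ j in qj1 *; nra.
Qed.

(** Induction on the exponent. If the new power of [q] is at least 1/5, convexity bounds the gap by
    (1 - 1/5) / 2. Otherwise the previous power [a] is at most 2/5, and then [(1 + q) / 2 * (a + 2 /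
    5) - q * a <= 2 / 5]. *)
Lemma expr_gap (q : R) j : 0 <= q <= 1 ->
  ((1 + q) / 2) ^+ j.+2 - q ^+ j.+2 <= 2 / 5.
Proof.
move=> q01; case/andP: (q01) => q0 q1; elim: j => [|j IH]; first by rewrite !expr2; nra.
have mid := expr_midpoint j.+3 q01.
have [big|small] := leP (1 / 5) (q ^+ j.+3); first lra.
have qj0 : 0 <= q ^+ j.+2 by exact: exprn_ge0.
have qj : q ^+ j.+2 <= 2 / 5.
  rewrite leNgt; apply/negP => qj.
  have : q ^+ j.+2 <= q ^+ 2 by exact: ler_wiXn2l.
  move: small; rewrite exprS expr2; set a := q ^+ j.+2 in qj *; nra.
rewrite (exprS _ j.+2) (exprS q j.+2).
set a := q ^+ j.+2 in IH qj qj0 *; set b := _ ^+ j.+2 in IH *; nra.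
Qed.

Lemma pw_midpoint (q : R) z : 0 <= q <= 1 -> pw ((1 + q) / 2) z <= (pw q z + 1) / 2.
Proof.
by move=> q01; case: z => [j|] /=; [rewrite [_ + 1]addrC; exact: expr_midpoint|lra].
Qed.

(** Equality holds at state 1, where the gap is [(1 - q) / 2]; at all other states it is at most
    2/5. After integration the last term brings in the coefficient of [s]. *)
Lemma pw_gap (q : R) z : 0 <= q <= 1 ->
  pw ((1 + q) / 2) z <=
  pw q z + 2 / 5 + (1 / 10 - q / 2) * (z == fin_state 1)%:R.
Proof.
move=> q01; case: z => [[|[|j]]|]; rewrite /pw.
- by rewrite [_ == _](_ : _ = false)//= !expr0; lra.
- by rewrite eqxx /= !expr1; lra.
- by rewrite [_ == _](_ : _ = false)//=; have := expr_gap j q01; lra.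
- by rewrite [_ == _](_ : _ = false)//=; lra.
Qed.

(** On [0, 1/3] powers with exponent at least 2 have slope at most 2/3, while exponent 1 has slope
    1. *)
Lemma pw_slope (s t : R) z : 0 <= s -> s <= t -> t <= 1 / 3 ->
  pw t z - pw s z <= (t - s) * (2 / 3 + 1 / 3 * (z == fin_state 1)%:R).
Proof.
move=> s0 st t3; case: z => [[|[|j]]|]; rewrite /pw.
- by rewrite !expr0 [_ == _](_ : _ = false)//=; lra.
- by rewrite eqxx /= !expr1; lra.
- rewrite [_ == _](_ : _ = false)//=.
  have -> : 2 / 3 + 1 / 3 * 0%:R = 2 / 3 :> R by lra.
  elim: j => [|j IH]; first by rewrite !expr2; nra.
  rewrite (exprS _ j.+2) (exprS s j.+2).
  have sj : s ^+ j.+2 <= 1 / 3.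
    have s1 : s ^+ j.+1 <= 1 by apply: exprn_ile1 => //; lra.
    by rewrite exprS; have := exprn_ge0 j.+1 s0; nra.
  have sj0 := exprn_ge0 j.+2 s0.
  have tj0 : 0 <= t by lra.
  set a := s ^+ j.+2 in IH sj sj0 *; set b := t ^+ j.+2 in IH *; nra.
- by rewrite [_ == _](_ : _ = false)//=; lra.
Qed.

End pw.

(** * Generating functions as expectations *)

Section expectation.
Context {R : realType} {d : measure_display} {T : measurableType d}.
Context {P : probability T R}.
Implicit Types (Y : T -> NDelta) (s : R).

Lemma measurable_pw Y s A : measurable_fun setT Y ->
  measurable_fun A (fun w => (pw s (Y w))%:E).
Proof.
move=> mY; apply/measurable_EFinP; apply: measurable_funTS.
by apply: (measurableT_comp (f := pw s)) => //.
Qed.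

Lemma bounded_integrable Y (u : NDelta -> R) A (M : R) : measurable A ->
  measurable_fun setT Y -> (forall z, `|u z| <= M)%R ->
  P.-integrable A (EFin \o (u \o Y)).
Proof.
move=> mA mY uM; apply: measurable_bounded_integrable => //.
- by rewrite ltey_eq fin_num_measure.
- apply: measurable_funTS; apply: (measurableT_comp (f := u)) => //.
- exists M; split; first exact: num_real.
  by move=> M' MM' w _; exact: le_trans (uM _) (ltW MM').
Qed.

Definition egf Y s : R := (\int[P]_w pw s (Y w))%R.

Lemma EFin_egf Y s : measurable_fun setT Y -> (0 <= s <= 1)%R ->
  (egf Y s)%:E = \int[P]_w (pw s (Y w))%:E.
Proof.
move=> mY s01; rewrite /egf /Rintegral fineK//.
apply: integrable_fin_num => //; apply: (@bounded_integrable _ _ _ 1) => // z.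
by rewrite ger0_norm ?pw_le1// pw_ge0//; case/andP: s01.
Qed.

(** Linearity and monotonicity of the integral, packaged once: the estimates on generating functions
    below reduce through it to pointwise estimates on [pw]. *)
Lemma egf_le Y (x y a b c : R) : measurable_fun setT Y ->
  (0 <= x <= 1)%R -> (0 <= y <= 1)%R ->
  (forall z, pw x z <= a * pw y z + b + c * (z == fin_state 1)%:R)%R ->
  (egf Y x <= a * egf Y y + b + c * fine (P (Y @^-1` [set fin_state 1])))%R.
Proof.
move=> mY x01 y01 H; rewrite /egf.
have ipw s : (0 <= s <= 1)%R -> P.-integrable setT (EFin \o (pw s \o Y)).
  move=> s01; apply: (@bounded_integrable _ _ _ 1) => // z.
  by rewrite ger0_norm ?pw_le1// pw_ge0//; case/andP: s01.
pose e (z : NDelta) : R := (z == fin_state 1)%:R.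
have ie : P.-integrable setT (EFin \o (e \o Y)).
  by apply: (@bounded_integrable _ _ _ 1) => // z; rewrite ger0_norm /e; case: eqP.
have mA : measurable (Y @^-1` [set fin_state 1]) by rewrite -[_ @^-1` _]setTI; exact: mY.
have Ee : (\int[P]_w (e (Y w)) = fine (P (Y @^-1` [set fin_state 1])))%R.
  rewrite -[X in P X]setIT -integral_indic// /Rintegral; congr fine.
  apply: eq_integral => w _; rewrite /e indicE; congr (_%:R%:E); congr nat_of_bool.
  by apply/eqP/idP => [Yw|]; rewrite inE.
rewrite -Ee.
have iK (k : R) : P.-integrable setT (EFin \o (cst k : T -> R)).
  by apply: finite_measure_integrable_cst.
have iM (k : R) u : P.-integrable setT (EFin \o (u \o Y)) ->
  P.-integrable setT (EFin \o (fun w => k * u (Y w))%R).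
  move=> iu; rewrite (_ : _ \o _ = (fun w => k%:E * (EFin \o (u \o Y)) w))//.
  exact: integrableZl.
have iD u v : P.-integrable setT (EFin \o u) -> P.-integrable setT (EFin \o v) ->
   P.-integrable setT (EFin \o (fun w => u w + v w)%R).
  by move=> iu iv; exact: (integrableD measurableT iu iv).
have ia := iM a _ (ipw _ y01).
have ic := iM c _ ie.
have iab := iD _ _ ia (iK b).
apply: (@le_trans _ _ (\int[P]_w (a * pw y (Y w) + b + c * e (Y w)))%R).
  by apply: le_Rintegral => //; [exact: ipw|exact: iD].
rewrite (RintegralD measurableT iab ic) (RintegralD measurableT ia (iK b)).
rewrite (RintegralZl _ measurableT (ipw _ y01)) (RintegralZl _ measurableT ie).
have PT : fine (P setT) = 1%R by rewrite probability_setT.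
by rewrite (Rintegral_cst P measurableT b) PT mulr1.
Qed.

End expectation.

Section partition.
Context {R : realType} {d : measure_display} {T : measurableType d}.
Context {P : probability T R}.

Lemma measurable_NDelta (Y : T -> NDelta) :
  (forall a, measurable (Y @^-1` [set a])) -> measurable_fun setT Y.
Proof.
move=> mY _ B _; rewrite setTI; apply: preimage_countable => //.
by move=> F mF; exact: bigcupT_measurable.
Qed.

(** The integrand vanishes on the graveyard, so the finite states carry the whole integral. *)
Lemma integral_NDelta_partition (Y : T -> NDelta) (A : set T) (u : T -> \bar R) :
  measurable A -> (forall a, measurable (Y @^-1` [set a])) ->
  measurable_fun setT u -> (forall w, 0 <= u w) ->
  (forall w, Y w = graveyard -> u w = 0) ->
  \int[P]_(w in A) u w =
  \sum_(b <oo) \int[P]_(w in A `&` Y @^-1` [set fin_state b]) u w.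
Proof.
move=> mA mY mu u0 uD.
have mF b : measurable (A `&` Y @^-1` [set fin_state b]) by exact: measurableI.
rewrite -ge0_integral_bigcup//.
- rewrite -setI_bigcupr integral_mkcondr; apply: eq_integral => w _.
  rewrite patchE; case: ifPn => // /negP Yw.
  rewrite uD//; case E: (Y w) => [b|//]; case: Yw.
  by rewrite inE; exists b.
- exact: measurable_funTS.
- move=> a b _ _ [w [[_ /= Ya] [_ /= Yb]]].
  by move: Ya; rewrite Yb => -[].
Qed.

End partition.

(** * Factorization of expectations under independence *)

Section independence.
Context {R : realType} {d : measure_display} {T : measurableType d}.
Context {P : probability T R} {I : choiceType}.
Context (X : I -> {RV P >-> NDelta}) (D0 : set I).
Context (X_indep : mutually_independent D0 X).
Implicit Types (D : set I) (A : set T) (s : R).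

Lemma measurable_RV_NDelta i a : measurable (X i @^-1` [set a]).
Proof. exact: measurable_RV_preimage. Qed.

Lemma integral_pw_law i A s : measurable A -> (0 <= s)%R ->
  \int[P]_(w in A) (pw s (X i w))%:E =
  \sum_(b <oo) (s ^+ b)%:E * P (A `&` X i @^-1` [set fin_state b]).
Proof.
move=> mA s0; rewrite (integral_NDelta_partition (Y := X i))//; first last.
- by move=> w ->.
- by move=> w; rewrite lee_fin pw_ge0.
- by apply: measurable_pw; exact/measurable_NDelta/measurable_RV_NDelta.
- exact: measurable_RV_NDelta.
apply: eq_eseriesr => b _.
have mAb : measurable (A `&` X i @^-1` [set fin_state b]).
  by apply: measurableI => //; exact: measurable_RV_NDelta.
rewrite -integral_cst//; apply: eq_integral => w.
by rewrite inE => -[_ /= ->].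
Qed.

Lemma integral_pw_indep D i A s : D `<=` D0 -> D0 i -> ~ D i ->
  history X D A -> (0 <= s <= 1)%R ->
  \int[P]_(w in A) (pw s (X i w))%:E = P A * (egf (P := P) (X i) s)%:E.
Proof.
move=> DD0 D0i nDi hA s01; have mA := history_measurable hA.
have [s0 _] := andP s01.
have mX := measurable_NDelta (measurable_RV_NDelta i).
rewrite (EFin_egf mX s01).
rewrite !integral_pw_law// -(fineK (fin_num_measure P _ mA)) -nneseriesZl.
  apply: eq_eseriesr => b _; rewrite setTI fineK ?fin_num_measure//.
  by rewrite (history_indep X_indep DD0 D0i nDi hA)// muleCA.
by move=> b _; rewrite mule_ge0// lee_fin exprn_ge0.
Qed.

(** Cut [A] by the value of [S]: each piece is still an event of the history, and on it the factor
    coming from [S] is constant. *)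
Lemma integral_pw_mul_indep D i (S : T -> NDelta) A s : D `<=` D0 -> D0 i -> ~ D i ->
  history X D A -> (forall a, history X D (S @^-1` [set a])) -> (0 <= s <= 1)%R ->
  \int[P]_(w in A) (pw s (S w) * pw s (X i w))%:E =
  \int[P]_(w in A) (pw s (S w))%:E * (egf (P := P) (X i) s)%:E.
Proof.
move=> DD0 D0i nDi hA hS s01; have [s0 _] := andP s01.
have mA := history_measurable hA.
have mS a : measurable (S @^-1` [set a]) by exact: (history_measurable (hS a)).
have g0 : (0 <= egf (P := P) (X i) s)%R.
  by apply: Rintegral_ge0 => w _; exact: pw_ge0.
rewrite (integral_NDelta_partition (Y := S))//; first last.
- by move=> w -> /=; rewrite mul0r.
- by move=> w; rewrite lee_fin mulr_ge0// pw_ge0.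
- apply/measurable_EFinP; apply: measurable_funM; apply/measurable_EFinP.
    by apply: measurable_pw; exact/measurable_NDelta.
  by apply: measurable_pw; exact/measurable_NDelta/measurable_RV_NDelta.
rewrite (integral_NDelta_partition (Y := S) (u := fun w => (pw s (S w))%:E))//; first last.
- by move=> w ->.
- by move=> w; rewrite lee_fin pw_ge0.
- by apply: measurable_pw; exact/measurable_NDelta.
rewrite muleC -nneseriesZl; last first.
  by move=> b _; apply: integral_ge0 => w _; rewrite lee_fin pw_ge0.
apply: eq_eseriesr => b _.
have hAb : history X D (A `&` S @^-1` [set fin_state b]) by exact: history_setI.
have mAb := history_measurable hAb.
transitivity (\int[P]_(w in A `&` S @^-1` [set fin_state b])
    ((s ^+ b)%:E * (pw s (X i w))%:E)).
  by apply: eq_integral => w; rewrite inE => -[_ /= ->].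
rewrite ge0_integralZl//; first last.
- by rewrite lee_fin exprn_ge0.
- by move=> w _; rewrite lee_fin pw_ge0.
- by apply: measurable_pw; exact/measurable_NDelta/measurable_RV_NDelta.
rewrite (integral_pw_indep DD0 D0i nDi)//.
rewrite muleA -integral_cst// muleC; congr (_ * _).
by apply: eq_integral => w; rewrite inE => -[_ /= ->].
Qed.

End independence.

(** * The branching property *)

Lemma addDA : associative addD.
Proof. by move=> [a|] [b|] [c|]//=; rewrite addnA. Qed.

Lemma add0D : left_id (fin_state 0) addD.
Proof. by case. Qed.

Lemma addD0 : right_id (fin_state 0) addD.
Proof. by case=> //= a; rewrite addn0. Qed.

HB.instance Definition _ :=
  Monoid.isLaw.Build NDelta (fin_state 0) addD addDA add0D addD0.

Lemma sumD_rec a (x : nat -> NDelta) :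
  sumD (fin_state a.+1) x = addD (sumD (fin_state a) x) (x a.+1).
Proof. by rewrite /= big_nat_recr. Qed.

Lemma sumD_cst a b (x : nat -> NDelta) :
  (forall j, (1 <= j <= a)%N -> x j = fin_state b) ->
  sumD (fin_state a) x = fin_state (a * b).
Proof.
elim: a => [|a IH] xb; first by rewrite /= big_geq.
rewrite sumD_rec IH => [|j /andP[j1 ja]]; last by apply: xb; rewrite j1 leqW.
by rewrite xb ?leqnn//= mulSn addnC.
Qed.

Section branching.
Context {R : realType} {d : measure_display} {T : measurableType d}.
Context {P : probability T R} {f : nat -> nat -> R}.
Context {X : nat -> nat -> {RV P >-> NDelta}}.
Context (X_law : forall n j, (1 <= n)%N -> (1 <= j)%N -> has_law (X n j) (f n)).
Context (X_indep : mutually_independent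
       [set i : nat * nat | (1 <= i.1)%N && (1 <= i.2)%N]
       (fun i => X i.1 i.2)).
Implicit Types (A : set T) (s : R).

(* The individuals of the generations up to [n], together with the first [a]
   individuals of generation [n + 1]. *)
Definition born n a : set (nat * nat) :=
  [set i | [&& (1 <= i.1)%N, (1 <= i.2)%N &
               (i.1 <= n)%N || ((i.1 == n.+1) && (i.2 <= a)%N)]].

(** At [a = 0] this is the natural filtration; positive [a] lets the next generation be revealed one
    individual at a time. *)
Definition past n a : set_system T := history (fun i => X i.1 i.2) (born n a).

Lemma born_sub n a : born n a `<=` [set i : nat * nat | (1 <= i.1)%N && (1 <= i.2)%N].
Proof. by move=> i /= /and3P[-> ->]. Qed.

Lemma past_measurable n a A : past n a A -> measurable A.
Proof. exact: history_measurable. Qed.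

Lemma past_subset n a m b :
  (forall i, born n a i -> born m b i) -> past n a `<=` past m b.
Proof. exact: history_subset. Qed.

Lemma past_widen n a : past n 0 `<=` past n a.
Proof. by apply: past_subset => -[x y]; rewrite /born /=; lia. Qed.

Lemma past_next n a : past n a `<=` past n.+1 0.
Proof. by apply: past_subset => -[x y]; rewrite /born /=; lia. Qed.

Lemma past_le m n : (m <= n)%N -> past m 0 `<=` past n 0.
Proof. by move=> mn; apply: past_subset => -[x y]; rewrite /born /=; lia. Qed.

Lemma past_offspring n a c : past n a.+1 (X n.+1 a.+1 @^-1` [set c]).
Proof.
apply: (@history_preimage _ _ _ _ _ _ _ (fun i : nat * nat => X i.1 i.2) _
  (n.+1, a.+1)) => //.
by rewrite /born /= eqxx leqnn orbT.
Qed.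

Lemma past_sumD n a b :
  past n a ((fun w => sumD (fin_state a) (X n.+1 ^~ w)) @^-1` [set b]).
Proof.
elim: a b => [|a IH] b.
  rewrite (_ : _ @^-1` _ = if b == fin_state 0 then setT else set0).
    by case: ifP => _; [exact: history_setT|exact: history_set0].
  apply/seteqP; split => [w /=|w]; rewrite ?big_geq//.
    by move=> <-; rewrite eqxx.
  by case: eqP => //= ->; rewrite big_geq.
pose Y w : NDelta * NDelta := (sumD (fin_state a) (X n.+1 ^~ w), X n.+1 a.+1 w).
rewrite (_ : _ @^-1` _ = Y @^-1` [set p | addD p.1 p.2 = b]); last first.
  by apply/seteqP; split => w; rewrite /preimage /mkset sumD_rec.
apply: preimage_countable; [exact: history_set0|exact: history_bigcup|].
move=> [x y]; rewrite (_ : _ @^-1` _ =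
  (fun w => sumD (fin_state a) (X n.+1 ^~ w)) @^-1` [set x] `&`
  X n.+1 a.+1 @^-1` [set y]); last first.
  by apply/seteqP; split => w; [move=> [/= <- <-]|move=> [/= <- <-]].
apply: history_setI; last exact: past_offspring.
move: (IH x); apply: past_subset => -[u v]; rewrite /born /=; lia.
Qed.

(** The process restarted at time [m] from [i] individuals, with the same offspring variables. For
    [i = 1] its generating function is the composition of those of generations [m + 1] to
    [m + r]. *)
Fixpoint gw_from m i r w : NDelta :=
  if r is r'.+1 then sumD (gw_from m i r' w) (X (m + r').+1 ^~ w)
  else fin_state i.

Lemma gw_from0 n : gw_process X n = gw_from 0 1 n.
Proof. by elim: n => //= n IH; apply/funext => w; rewrite IH. Qed.

Lemma past_gw_step n (W : T -> NDelta) b :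
  (forall a, past n 0 (W @^-1` [set a])) ->
  past n.+1 0 ((fun w => sumD (W w) (X n.+1 ^~ w)) @^-1` [set b]).
Proof.
move=> hW.
rewrite (_ : _ @^-1` _ =
  (W @^-1` [set graveyard] `&` (if b == graveyard then setT else set0)) `|`
  \bigcup_a (W @^-1` [set fin_state a] `&`
     (fun w => sumD (fin_state a) (X n.+1 ^~ w)) @^-1` [set b])); last first.
  apply/seteqP; split => [w|w [[/= -> ]|[a _ [/= -> //]]]].
    move=> Wb; case E: (W w) => [a|]; [right|left].
      by exists a => //; split => //=; move: Wb; rewrite /= E.
    by split => //; move: Wb; rewrite /= E => <-; rewrite eqxx.
  by case: eqP.
apply: history_setU; last first.
  apply: history_bigcup => a; apply: history_setI.
    exact: past_next (hW _).
  by apply: past_next; exact: past_sumD.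
apply: history_setI; first exact: past_next (hW _).
by case: ifP => _; [exact: history_setT|exact: history_set0].
Qed.

Lemma past_gw_from m i r b : past (m + r) 0 (gw_from m i r @^-1` [set b]).
Proof.
elim: r b => [|r IH] b /=.
  rewrite (_ : _ @^-1` _ = if b == fin_state i then setT else set0).
    by case: ifP => _; [exact: history_setT|exact: history_set0].
  apply/seteqP; split => [w /= <-|w]; first by rewrite eqxx.
  by case: eqP => //= ->.
by rewrite addnS; exact: past_gw_step.
Qed.

Definition gf n s : R := egf (P := P) (X n 1%N) s.

Lemma measurable_offspring n j : measurable_fun setT (X n j).
Proof. by []. Qed.

Lemma egf_offspring n j s : (1 <= n)%N -> (1 <= j)%N -> (0 <= s <= 1)%R ->
  egf (P := P) (X n j) s = gf n s.
Proof.
move=> n1 j1 s01; apply: EFin_inj; rewrite !EFin_egf//; have [s0 _] := andP s01.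
rewrite (integral_pw_law (X n) j measurableT s0).
rewrite (integral_pw_law (X n) 1%N measurableT s0).
apply: eq_eseriesr => b _; rewrite !setTI.
by rewrite (proj1 (X_law n1 j1)) (proj1 (X_law n1 (leqnn 1))).
Qed.

Lemma egf_itv (Y : T -> NDelta) s : measurable_fun setT Y ->
  (0 <= s <= 1)%R -> (0 <= egf (P := P) Y s <= 1)%R.
Proof.
move=> mY s01; apply/andP; split.
  by apply: Rintegral_ge0 => w _; apply: pw_ge0; case/andP: s01.
have := egf_le (P := P) (a := 0) (b := 1) (c := 0) mY s01 s01.
by rewrite !mul0r addr0 add0r; apply => z; rewrite !mul0r addr0 add0r pw_le1.
Qed.

Lemma gf_itv n s : (0 <= s <= 1)%R -> (0 <= gf n s <= 1)%R.
Proof. by move=> s01; exact: egf_itv. Qed.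

(** Induction on [a]: individual [a + 1] is outside [born n a], hence independent of both [A] and
    the partial sum. *)
Lemma integral_pw_sumD n a A s : past n 0 A -> (0 <= s <= 1)%R ->
  \int[P]_(w in A) (pw s (sumD (fin_state a) (X n.+1 ^~ w)))%:E =
  P A * (gf n.+1 s ^+ a)%:E.
Proof.
move=> hA s01; elim: a => [|a IH].
  rewrite expr0 muleC -integral_cst//; last exact: past_measurable hA.
  by apply: eq_integral => w _; rewrite /= big_geq.
rewrite exprSr EFinM muleA -IH -(@egf_offspring _ a.+1)//.
have nborn : ~ born n a (n.+1, a.+1) by rewrite /born /=; lia.
have hA' : past n a A by exact: past_widen.
have hS b : past n a ((fun w => sumD (fin_state a) (X n.+1 ^~ w)) @^-1` [set b]).
  exact: past_sumD.
have mul := integral_pw_mul_indep X_indep (@born_sub n a)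
  (isT : [set i : nat * nat | (1 <= i.1)%N && (1 <= i.2)%N] (n.+1, a.+1)) nborn hA' hS s01.
rewrite -[RHS]mul; apply: eq_integral => w _.
by rewrite -pw_addD -sumD_rec.
Qed.

(** The branching property, with conditional expectation given the past expressed by integrals over
    past events. *)
Lemma integral_pw_step n (W : T -> NDelta) A s :
  (forall a, past n 0 (W @^-1` [set a])) -> past n 0 A -> (0 <= s <= 1)%R ->
  \int[P]_(w in A) (pw s (sumD (W w) (X n.+1 ^~ w)))%:E =
  \int[P]_(w in A) (pw (gf n.+1 s) (W w))%:E.
Proof.
move=> hW hA s01; have [s0 _] := andP s01; have [g0 _] := andP (gf_itv n.+1 s01).
have mW a := past_measurable (hW a).
have mA := past_measurable hA.
rewrite (integral_NDelta_partition (Y := W))//; first last.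
- by move=> w ->.
- by move=> w; rewrite lee_fin pw_ge0.
- apply: measurable_pw; apply: measurable_NDelta => b.
  exact: past_measurable (past_gw_step b hW).
rewrite (integral_NDelta_partition (Y := W)
  (u := fun w => (pw (gf n.+1 s) (W w))%:E))//; first last.
- by move=> w ->.
- by move=> w; rewrite lee_fin pw_ge0.
- by apply: measurable_pw; exact: measurable_NDelta.
apply: eq_eseriesr => a _.
have hAa : past n 0 (A `&` W @^-1` [set fin_state a]) 
  by apply: history_setI; [exact: hA|exact: hW].
transitivity (\int[P]_(w in A `&` W @^-1` [set fin_state a])
    (pw s (sumD (fin_state a) (X n.+1 ^~ w)))%:E).
  by apply: eq_integral => w; rewrite inE => -[_ /= ->].
rewrite integral_pw_sumD// muleC -integral_cst; last exact: past_measurable hAa.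
by apply: eq_integral => w; rewrite inE => -[_ /= ->].
Qed.

End branching.

(** * Iterated generating functions and optional stopping *)

Section composition.
Context {R : realType} {d : measure_display} {T : measurableType d}.
Context {P : probability T R} {f : nat -> nat -> R}.
Context {X : nat -> nat -> {RV P >-> NDelta}}.
Context (X_law : forall n j, (1 <= n)%N -> (1 <= j)%N -> has_law (X n j) (f n)).
Context (X_indep : mutually_independent
       [set i : nat * nat | (1 <= i.1)%N && (1 <= i.2)%N]
       (fun i => X i.1 i.2)).
Implicit Types (A : set T) (s : R).

Local Notation past n := (past (X := X) n 0).
Local Notation Z := (gw_process X).
Local Notation gf := (gf (X := X)).

(** This is [g_(m+1) o ... o g_(m+r)], the earliest generation being outermost. *)
Fixpoint gf_comp m r s : R :=
  if r is r'.+1 then gf m.+1 (gf_comp m.+1 r' s) else s.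

Lemma gf_compD m r r' s : gf_comp m (r + r') s = gf_comp m r (gf_comp (m + r) r' s).
Proof.
elim: r m => [|r IH] m /=; first by rewrite addn0.
by rewrite IH addSnnS.
Qed.

Lemma gf_comp_itv m r s : (0 <= s <= 1)%R -> (0 <= gf_comp m r s <= 1)%R.
Proof. by move=> s01; elim: r m => [//|r IH] m /=; exact: gf_itv. Qed.

(** The last generation is innermost, so the induction peels it off first. [W] is general in order
    to cover both the process after time [m] and [gw_from]. *)
Lemma integral_pw_comp m r (W : nat -> T -> NDelta) A s :
  (forall l b, past (m + l) (W l @^-1` [set b])) ->
  (forall l, W l.+1 = fun w => sumD (W l w) (X (m + l).+1 ^~ w)) ->
  past m A -> (0 <= s <= 1)%R ->
  \int[P]_(w in A) (pw s (W r w))%:E =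
  \int[P]_(w in A) (pw (gf_comp m r s) (W 0 w))%:E.
Proof.
move=> hW WS hA; elim: r s => [//|r IH] s s01.
have hA' : past (m + r) A by move: hA; apply: past_le; rewrite leq_addr.
rewrite WS.
have step := integral_pw_step X_law X_indep (hW r) hA' s01.
rewrite [LHS]step.
have -> : gf_comp m r.+1 s = gf_comp m r (gf (m + r).+1 s).
  by rewrite -addn1 gf_compD.
by apply: IH; exact: gf_itv.
Qed.

Lemma past_gw n b : past n (Z n @^-1` [set b]).
Proof. by rewrite gw_from0; exact: (@past_gw_from _ _ _ _ X 0%N 1%N n b). Qed.

Lemma measurable_gw n b : measurable (Z n @^-1` [set b]).
Proof. exact: (past_measurable (past_gw b)). Qed.

Lemma integral_pw_gw m r k A s : past m A -> A `<=` Z m @^-1` [set fin_state k] ->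
  (0 <= s <= 1)%R ->
  \int[P]_(w in A) (pw s (Z (m + r) w))%:E = P A * (gf_comp m r s ^+ k)%:E.
Proof.
move=> hA Ak s01; rewrite (@integral_pw_comp m r (fun l => Z (m + l)))//.
- rewrite muleC -integral_cst; last exact: past_measurable hA.
  by apply: eq_integral => w; rewrite inE addn0 => /Ak /= ->.
- by move=> l b; exact: past_gw.
- by move=> l; rewrite addnS.
Qed.

Lemma measurable_gw_from m i r : measurable_fun setT (gw_from (X := X) m i r).
Proof.
by apply: measurable_NDelta => b; apply: past_measurable; exact: past_gw_from.
Qed.

Lemma egf_gw_from m i r s : (0 <= s <= 1)%R ->
  egf (P := P) (gw_from (X := X) m i r) s = (gf_comp m r s ^+ i)%R.
Proof.
move=> s01; apply: EFin_inj; rewrite EFin_egf//; last exact: measurable_gw_from.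
rewrite (@integral_pw_comp m r (gw_from (X := X) m i))//.
- by rewrite -[RHS]mule1 -(probability_setT P) -integral_cst.
- by move=> l b; exact: past_gw_from.
- exact: history_setT.
Qed.

Lemma gw_absorb0 n l w : Z n w = fin_state 0 -> Z (n + l) w = fin_state 0.
Proof.
move=> Zn; elim: l => [|l IH]; first by rewrite addn0.
by rewrite addnS /= IH /= big_geq.
Qed.

Lemma gw_absorbD n l w : Z n w = graveyard -> Z (n + l) w = graveyard.
Proof. by move=> Zn; elim: l => [|l IH]; rewrite ?addn0// addnS /= IH. Qed.

(** Convexity together with [g_n(1) <= 1]; this is the supermartingale inequality behind
    [visits_le]. *)
Lemma gf_midpoint n (q : R) : (0 <= q <= 1)%R ->
  (gf n ((1 + q) / 2) <= (1 + gf n q) / 2)%R.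
Proof.
move=> q01; have := @egf_le _ _ _ P (X n 1%N) ((1 + q) / 2)%R q (1 / 2)%R (1 / 2)%R 0%R
  (@measurable_offspring _ _ _ _ X n 1%N).
move=> /(_ _ q01); rewrite mul0r addr0 => H.
suff : (gf n ((1 + q) / 2) <= 1 / 2 * gf n q + 1 / 2)%R by lra.
apply: H; first by case/andP: q01 => q0 q1; apply/andP; split; lra.
by move=> z; have := pw_midpoint z q01; lra.
Qed.

(** Splitting off time [m] matches the optional stopping induction; [visitsP] gives the closed
    form. *)
Fixpoint visits k m r : set T :=
  Z m @^-1` [set fin_state k] `|` (if r is r'.+1 then visits k m.+1 r' else set0).

Lemma visitsP k m r w :
  visits k m r w <-> exists2 l, (l <= r)%N & Z (m + l) w = fin_state k.
Proof.
elim: r m => [|r IH] m /=.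
  split; first by case=> // Zm; exists 0%N; rewrite ?addn0.
  by move=> [[|l]//]; rewrite addn0; left.
split.
  move=> [Zm|/IH[l lr]]; first by exists 0%N; rewrite ?addn0.
  by rewrite addSnnS => Zl; exists l.+1.
move=> [[|l]]; first by rewrite addn0; left.
by rewrite ltnS -addSnnS => lr Zl; right; apply/IH; exists l.
Qed.

Lemma measurable_visits k m r : measurable (visits k m r).
Proof.
elim: r m => [|r IH] m /=; apply: measurableU => //; exact: measurable_gw.
Qed.

(** One step of optional stopping: on [B] the process sits at [k] and [s >= 1 / 2], so the integrand
    is at least [(1 / 2) ^+ k]; off [B] the hypothesis takes over. *)
Lemma le_integral_pw_gw k m A V s : measurable A -> measurable V ->
  (1 / 2 <= s)%R -> (s <= 1)%R ->
  let B := Z m @^-1` [set fin_state k] in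
  ((1 / 2) ^+ k)%:E * P ((A `\` B) `&` V) <=
    \int[P]_(w in A `\` B) (pw s (Z m w))%:E ->
  ((1 / 2) ^+ k)%:E * P (A `&` (B `|` V)) <= \int[P]_(w in A) (pw s (Z m w))%:E.
Proof.
move=> mA mV s2 s1 B IH; have s0 : (0 <= s)%R by lra.
have mB : measurable B by exact: measurable_gw.
have mAB : measurable (A `&` B) by exact: measurableI.
have mAD : measurable (A `\` B) by exact: measurableD.
have mpw : measurable_fun setT (fun w => (pw s (Z m w))%:E).
  by apply: measurable_pw; apply: measurable_NDelta => b; exact: measurable_gw.
have IB : ((1 / 2) ^+ k)%:E * P (A `&` B) <=
    \int[P]_(w in A `&` B) (pw s (Z m w))%:E.
  rewrite -integral_cst//; apply: ge0_le_integral => //.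
  - by move=> w _; rewrite lee_fin exprn_ge0//; lra.
  - exact: measurable_funTS.
  - by move=> w [_ /= ->]; rewrite lee_fin /=; apply: lerXn2r; rewrite ?nnegrE//; lra.
have -> : \int[P]_(w in A) (pw s (Z m w))%:E =
    \int[P]_(w in (A `&` B) `|` (A `\` B)) (pw s (Z m w))%:E by rewrite setUIDK.
rewrite ge0_integral_setU//; last 3 first.
- exact: measurable_funTS.
- by move=> w _; rewrite lee_fin pw_ge0.
- by apply/disj_setPS => w [[_ Bw] [_ nBw]].
apply: le_trans (leeD IB IH).
rewrite -ge0_muleDr ?measure_ge0//; apply: lee_wpmul2l.
  by rewrite lee_fin exprn_ge0//; lra.
have -> : A `&` (B `|` V) = (A `&` B) `|` ((A `\` B) `&` V).
  apply/seteqP; split => w.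
    move=> [Aw [Bw|Vw]]; first by left.
    by have [Bw|nBw] := pselect (B w); [left|right].
  by move=> [[Aw Bw]|[[Aw nBw] Vw]]; split => //; [left|right].
by apply: measureU2 => //; exact: measurableI.
Qed.

(* With q_n = gf_comp n r 0 the numbers ((1 + q_n) / 2) ^ Z_n form a bounded
   supermartingale, which is at least 2 ^ - k whenever Z_n = k. *)
Lemma visits_le k m r A : past m A ->
  ((1 / 2) ^+ k)%:E * P (A `&` visits k m r) <=
  \int[P]_(w in A) (pw ((1 + gf_comp m r 0) / 2) (Z m w))%:E.
Proof.
have q01 m' r' : (0 <= gf_comp m' r' 0 <= 1)%R.
  by apply: gf_comp_itv; rewrite lexx ler01.
elim: r m A => [|r IH] m A hA; have mA := past_measurable hA.
  apply: le_integral_pw_gw => //=; [lra|lra|].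
  rewrite setI0 measure0 mule0; apply: integral_ge0 => w _.
  by rewrite lee_fin pw_ge0//; lra.
have /andP[q0 q1] := q01 m r.+1; have /andP[q'0 q'1] := q01 m.+1 r.
apply: le_integral_pw_gw => //; [exact: measurable_visits|lra|lra|].
set A' := A `\` _; have hA' : past m A' by apply: history_setD => //; exact: past_gw.
have hA'1 : past m.+1 A' by exact: past_next hA'.
apply: (le_trans (IH _ _ hA'1)).
set s' := ((1 + gf_comp m.+1 r 0) / 2)%R.
have s'01 : (0 <= s' <= 1)%R by rewrite /s'; lra.
have g01 := gf_itv (X := X) m.+1 s'01.
(* Off the visit at time [m], the weight at time [m + 1] turns into [gf m.+1 s'], which
   [gf_midpoint] bounds by the weight at time [m]. *)
have step := integral_pw_step X_law X_indep (@past_gw m) hA' s'01.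
rewrite [leLHS]step.
apply: ge0_le_integral => //.
- exact: past_measurable hA'.
- by move=> w _; rewrite lee_fin pw_ge0//; case/andP: g01.
- by apply: measurable_pw; apply: measurable_NDelta => b; exact: measurable_gw.
- by apply: measurable_pw; apply: measurable_NDelta => b; exact: measurable_gw.
- move=> w _; rewrite lee_fin; apply: pw_le; first by case/andP: g01.
  exact: gf_midpoint.
Qed.

End composition.

(** * Recurrent states *)

Section localization.
Context {R : realType} {d : measure_display} {T : measurableType d}.
Context {P : probability T R}.

(** The tail unions decrease to the limsup, and each is the disjoint union of its first-entrance
    events. If the limsup had too small a share of every such event, it would have too small a share
    of a late tail union. *)
Lemma lim_sup_set_localize (F : nat -> set T) (e : R) :
  (forall n, measurable (F n)) -> (0 < e < 1)%R -> 0 < P (lim_sup_set F) ->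
  exists M i, (1 - e)%:E * P (seqDU (fun j => F (M + j)%N) i) <
              P (seqDU (fun j => F (M + j)%N) i `&` lim_sup_set F).
Proof.
move=> mF /andP[e0 e1] PE; set E := lim_sup_set F.
have mV n : measurable (\bigcup_(k >= n) F k) by exact: bigcup_measurable.
have mE : measurable E by apply: bigcap_measurable => //; exists 0%N.
have PEfin : P E \is a fin_num by exact: fin_num_measure.
set p := fine (P E); have p0 : (0 < p)%R by rewrite fine_gt0// PE ltey_eq PEfin.
have /fine_cvgP[_ /cvgrPdist_lt/(_ (e * p)%R (mulr_gt0 e0 p0))] :
    P (\bigcup_(k >= n) F k) @[n --> \oo] --> (fine (P E))%:E.
  by rewrite fineK//; apply: lim_sup_set_cvg => //; rewrite ltey_eq fin_num_measure.
move=> [M _ /(_ M (leqnn M))] /=; rewrite -/p => pV.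
set G := fun j => F (M + j)%N.
apply: contrapT => nloc.
have {}nloc i : P (seqDU G i `&` E) <= (1 - e)%:E * P (seqDU G i).
  by rewrite leNgt; apply/negP => loc; apply: nloc; exists M, i.
have mD i : measurable (seqDU G i).
  by apply: measurableD; [exact: mF|apply: bigsetU_measurable => j _; exact: mF].
have VE : \bigcup_i seqDU G i = \bigcup_(k >= M) F k.
  rewrite -seqDU_bigcup_eq; apply/seteqP; split => w [i].
    by move=> _ Fi; exists (M + i)%N => //=; rewrite leq_addr.
  by move=> /= Mi Fi; exists (i - M)%N; rewrite // /G subnKC.
have EV : E `<=` \bigcup_i seqDU G i by rewrite VE => w; apply.
have PE_le : P E <= (1 - e)%:E * P (\bigcup_i seqDU G i).
  rewrite -[in leLHS](setIidr EV) setI_bigcupl !measure_bigcup//; first last.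
  - exact/trivIset_setIr/trivIset_seqDU.
  - by move=> i _; exact: measurableI.
  rewrite -nneseriesZl//; apply: lee_nneseries => [i *|i *]; last exact: nloc.
  exact: measure_ge0.
move: PE_le; rewrite VE -[in leLHS](fineK PEfin).
have := fin_num_measure P _ (mV M) => PVfin.
rewrite -(fineK PVfin) -EFinM lee_fin -/p.
(* The choice of [M] gives [v < (1 + e) * p], hence [p <= (1 - e) * v < (1 - e ^ 2) * p], which is
   absurd. *)
set v := fine (P _) in pV *; move: pV; rewrite ltr_norml => /andP[pV _]; nra.
Qed.

End localization.

(** * Contraction along the orbits of the generating functions *)

Section iterates.
Context {R : realType} {d : measure_display} {T : measurableType d}.
Context {P : probability T R} {f : nat -> nat -> R}.
Context {X : nat -> nat -> {RV P >-> NDelta}}.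
Context (X_law : forall n j, (1 <= n)%N -> (1 <= j)%N -> has_law (X n j) (f n)).
Context (X_indep : mutually_independent
       [set i : nat * nat | (1 <= i.1)%N && (1 <= i.2)%N]
       (fun i => X i.1 i.2)).

Local Notation past n := (past (X := X) n 0).
Local Notation Z := (gw_process X).
Local Notation gf := (gf (X := X)).
Local Notation gf_comp := (gf_comp (X := X)).
(** The coefficient of [s] in [gf_comp m r]. *)
Local Notation one_from m r :=
  (fine (P (gw_from (X := X) m 1 r @^-1` [set fin_state 1]))).

Lemma offspring1 n : (1 <= n)%N -> fine (P (X n 1%N @^-1` [set fin_state 1])) = f n 1%N.
Proof. by move=> n1; rewrite (proj1 (X_law n1 (leqnn 1))). Qed.

Lemma offspring1_le1 n : (1 <= n)%N -> (f n 1%N <= 1)%R.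
Proof.
move=> n1; rewrite -lee_fin -(proj1 (X_law n1 (leqnn 1))).
by apply: probability_le1; exact: measurable_RV_preimage.
Qed.

Lemma gf_mono n (s t : R) : (0 <= s)%R -> (s <= t)%R -> (t <= 1)%R ->
  (gf n s <= gf n t)%R.
Proof.
move=> s0 st t1; have s01 : (0 <= s <= 1)%R by lra.
have t01 : (0 <= t <= 1)%R by lra.
have := egf_le (P := P) (a := 1%R) (b := 0%R) (c := 0%R)
  (@measurable_offspring _ _ _ _ X n 1%N) s01 t01.
rewrite mul1r mul0r !addr0; apply => z.
by rewrite mul1r mul0r !addr0 pw_le.
Qed.

Lemma gf_comp_mono m r (s t : R) : (0 <= s)%R -> (s <= t)%R -> (t <= 1)%R ->
  (gf_comp m r s <= gf_comp m r t)%R.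
Proof.
move=> s0 st t1; elim: r m => [//|r IH] m /=.
have /andP[? _] : (0 <= gf_comp m.+1 r s <= 1)%R by apply: gf_comp_itv; lra.
have /andP[_ ?] : (0 <= gf_comp m.+1 r t <= 1)%R by apply: gf_comp_itv; lra.
exact: gf_mono.
Qed.

Lemma gf_slope n (s t : R) : (1 <= n)%N -> (0 <= s)%R -> (s <= t)%R -> (t <= 1 / 3)%R ->
  (gf n t - gf n s <= (t - s) * (2 / 3 + 1 / 3 * f n 1%N))%R.
Proof.
move=> n1 s0 st t3; have s01 : (0 <= s <= 1)%R by lra.
have t01 : (0 <= t <= 1)%R by lra.
have := egf_le (P := P) (a := 1%R) (b := ((t - s) * (2 / 3))%R)
  (c := ((t - s) * (1 / 3))%R) (@measurable_offspring _ _ _ _ X n 1%N) t01 s01.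
rewrite (offspring1 n1) -/(gf n s) -/(gf n t) => H.
have {}H : (gf n t <= 1 * gf n s + (t - s) * (2 / 3) + (t - s) * (1 / 3) * f n 1%N)%R.
  by apply: H => z; have := pw_slope z s0 st t3; lra.
lra.
Qed.

(** By [gf_slope], generation [n] shrinks the distance of the two orbits by at least
    [(1 - f n 1) / 3] times its current value, which never falls below the final distance and so
    stays at least [c]. The losses add up. *)
Lemma gf_comp_slope m r (s t c : R) : (0 <= s)%R -> (s <= t)%R -> (t <= 1)%R ->
  (0 <= c)%R ->
  (forall l, (l <= r)%N -> gf_comp (m + l) (r - l) t <= 1 / 3)%R ->
  (c <= gf_comp m r t - gf_comp m r s)%R ->
  (gf_comp m r t - gf_comp m r s +
   c / 3 * \sum_(0 <= l < r) (1 - f (m + l).+1 1%N) <= t - s)%R.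
Proof.
move=> s0 st t1 c0; elim: r m => [|r IH] m small big /=.
  by rewrite big_geq// mulr0 addr0.
set p := gf_comp m.+1 r t; set z := gf_comp m.+1 r s.
have /andP[z0 _] : (0 <= z <= 1)%R by apply: gf_comp_itv; lra.
have zp : (z <= p)%R by exact: gf_comp_mono.
have p3 : (p <= 1 / 3)%R by have := small 1%N isT; rewrite addn1 subn1.
have slope := gf_slope (ltn0Sn m) z0 zp p3.
have a1 := offspring1_le1 (ltn0Sn m).
move: big; rewrite /= -/p -/z => big.
have cpz : (c <= p - z)%R by nra.
have /IH/(_ cpz) : (forall l, (l <= r)%N -> gf_comp (m.+1 + l) (r - l) t <= 1 / 3)%R.
  by move=> l lr; have := small l.+1 lr; rewrite subSS addSnnS.
rewrite big_nat_recl// addn0 -/p -/z.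
under [in X in _ -> X]eq_bigr do rewrite addnS -addSn.
set S := (\sum_(_ <= _ < _) _)%R => IH'.
nra.
Qed.

Lemma sum_offspring1 m i :
  (forall r, 17 / 20 <= one_from m r)%R ->
  (\sum_(0 <= l < i) (1 - f (m + l).+1 1%N) <= 1)%R.
Proof.
move=> one.
have mW r := measurable_gw_from (X := X) m 1 r.
have egfE r s : (0 <= s <= 1)%R ->
    egf (P := P) (gw_from (X := X) m 1 r) s = gf_comp m r s.
  by move=> s01; rewrite (egf_gw_from X_law X_indep)// expr1.
have lower r (s : R) : (0 <= s <= 1)%R ->
    (gf_comp m r 0 + one_from m r * s <= gf_comp m r s)%R.
  move=> s01; have z01 : (0 <= (0 : R) <= 1)%R by lra.
  have := egf_le (P := P) (a := 1%R) (b := 0%R) (c := (- s)%R) (mW r) z01 s01.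
  rewrite !egfE// => H.
  suff : (gf_comp m r 0 <= 1 * gf_comp m r s + 0 + - s * one_from m r)%R by lra.
  apply: H => -[[|[|j]]|]; rewrite /pw ?eqxx.
  - by rewrite [_ == _](_ : _ = false)//= !expr0; lra.
  - by rewrite /= !expr1; lra.
  - rewrite [_ == _](_ : _ = false)//= expr0n /=.
    by have := exprn_ge0 j.+2 (proj1 (andP s01)); lra.
  - by rewrite [_ == _](_ : _ = false)//=; lra.
have upper r (s : R) : (0 <= s <= 1)%R -> (gf_comp m r s <= gf_comp m r 0 + s)%R.
  move=> s01; have z01 : (0 <= (0 : R) <= 1)%R by lra.
  have := egf_le (P := P) (a := 1%R) (b := s) (c := 0%R) (mW r) s01 z01.
  rewrite !egfE// mul1r mul0r addr0; apply => z.
  by rewrite mul1r mul0r addr0; exact: pw_unit_le.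
(* The value at 0 is the probability of state 0, at most one minus that of state 1. *)
have zero r : (gf_comp m r 0 <= 3 / 20)%R.
  have z01 : (0 <= (0 : R) <= 1)%R by lra.
  have := egf_le (P := P) (a := 0%R) (b := 1%R) (c := (-1)%R) (mW r) z01 z01.
  rewrite !egfE// => H.
  have {}H : (gf_comp m r 0 <= 0 * gf_comp m r 0 + 1 + -1 * one_from m r)%R.
    apply: H => -[[|j]|]; rewrite /pw.
    - by rewrite [_ == _](_ : _ = false)//= !expr0; lra.
    - by rewrite expr0n /=; case: (_ == _) => /=; lra.
    - by rewrite [_ == _](_ : _ = false)//=; lra.
  by have := one r; lra.
have e01 : (0 <= (1 / 8 : R) <= 1)%R by lra.
(* The first [l] generations expand [p] by a factor at least 17/20, and the full composition stays
   below 3/20 + 1/8. Hence [p <= 11 / 34 < 1 / 3]. *)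
have small l : (l <= i)%N -> (gf_comp (m + l) (i - l) (1 / 8) <= 1 / 3)%R.
  move=> li; set p := gf_comp _ _ _.
  have p01 : (0 <= p <= 1)%R by exact: gf_comp_itv.
  have := lower l p p01; rewrite -gf_compD subnKC//.
  have := upper i _ e01; have := zero i; have := one l.
  have /andP[] : (0 <= gf_comp m l 0 <= 1)%R by apply: gf_comp_itv; lra.
  by move: p01; nra.
have big : (17 / 160 <= gf_comp m i (1 / 8) - gf_comp m i 0)%R.
  by have := lower i _ e01; have := one i; lra.
(* The result is [17 / 160 + 17 / 480 * S <= 1 / 8], that is [S <= 9 / 17]. *)
have := @gf_comp_slope m i 0 (1 / 8) (17 / 160) _ _ _ _ small big.
set S := (\sum_(_ <= _ < _) _)%R.
move=> H; have {}H := H ltac:(lra) ltac:(lra) ltac:(lra) ltac:(lra).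
lra.
Qed.

End iterates.

Lemma nneseries_bounded_sum {R : realType} (a : nat -> R) (m : nat) (C : R) :
  (forall n, (1 <= n)%N -> (0 <= a n)%R) ->
  (forall i, \sum_(0 <= l < i) a (m + l).+1 <= C)%R ->
  \sum_(1 <= n <oo) (a n)%:E < +oo.
Proof.
move=> a0 aC.
apply: (@le_lt_trans _ _ (\sum_(1 <= n < m.+1) a n + C)%:E); last exact: ltry.
apply: lime_le.
  by apply: is_cvg_nneseries => n n1 _; rewrite lee_fin a0.
near=> n; rewrite sumEFin lee_fin.
have mn : (m.+1 <= n)%N by near: n; exists m.+1.
rewrite (@big_cat_nat _ _ _ m.+1)//= lerD2l.
have := aC (n - m.+1)%N; rewrite -{2}[m.+1]add0n big_addn.
congr (_ <= _)%R; apply: eq_bigr => i _; congr a; lia.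
Unshelve. all: by end_near.
Qed.

Section recurrence.
Context {R : realType} {d : measure_display} {T : measurableType d}.
Context {P : probability T R} {f : nat -> nat -> R}.
Context {X : nat -> nat -> {RV P >-> NDelta}}.
Context (X_law : forall n j, (1 <= n)%N -> (1 <= j)%N -> has_law (X n j) (f n)).
Context (X_indep : mutually_independent
       [set i : nat * nat | (1 <= i.1)%N && (1 <= i.2)%N]
       (fun i => X i.1 i.2)).

Local Notation past n := (past (X := X) n 0).
Local Notation Z := (gw_process X).
Local Notation gf_comp := (gf_comp (X := X)).
Local Notation one_from m r :=
  (fine (P (gw_from (X := X) m 1 r @^-1` [set fin_state 1]))).
Local Notation recurrent k := (lim_sup_set (fun n => Z n @^-1` [set fin_state k])).

Lemma measurable_recurrent k : measurable (recurrent k).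
Proof.
apply: bigcap_measurable; first by exists 0%N.
by move=> n _; apply: bigcup_measurable => j _; exact: measurable_gw.
Qed.

(** Continuity from below in the horizon; the strict inequality already holds at some finite [r]. *)
Lemma recurrent_visits k m (c : R) H : measurable H ->
  c%:E < P (H `&` recurrent k) ->
  exists r, c%:E < P (H `&` visits (X := X) k m r).
Proof.
move=> mH cP; apply: contrapT => nr.
have mF r : measurable (H `&` visits (X := X) k m r).
  by apply: measurableI => //; exact: measurable_visits.
have ndF : nondecreasing_seq (fun r => H `&` visits (X := X) k m r).
  move=> r r' rr'; apply/subsetPset => w [Hw /visitsP[l lr Zl]]; split => //.
  by apply/visitsP; exists l => //; exact: leq_trans rr'.
have cvgF := nondecreasing_cvg_mu (mu := P) mF (bigcupT_measurable _ mF) ndF.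
have : limn (P \o (fun r => H `&` visits (X := X) k m r)) <= c%:E.
  apply: lime_le; first by apply/cvg_ex; eexists; exact: cvgF.
  by apply: nearW => r; rewrite leNgt; apply/negP => cr; apply: nr; exists r.
rewrite (cvg_lim _ cvgF)//.
apply/negP; rewrite -ltNge; apply: (lt_le_trans cP); apply: le_measure; rewrite ?inE.
- by apply: measurableI => //; exact: measurable_recurrent.
- exact: bigcupT_measurable.
move=> w [Hw Ew]; have [j /= mj Zj] := Ew m I.
exists (j - m)%N => //; split => //; apply/visitsP; exists (j - m)%N => //.
by rewrite subnKC.
Qed.

(** As [Z m] equals [k] on [H], integrals over [H] are [k]-th powers of compositions times [P H].
    The precision [del ^+ k] is chosen so that taking [k]-th roots leaves bounds in [del] alone. *)
Lemma one_from_recurrent k m H (i : nat) :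
  let del : R := (1 / 200)%R in
  (1 <= k)%N -> past m H -> H `<=` Z m @^-1` [set fin_state k] ->
  (1 - del ^+ k)%:E * P H < P (H `&` recurrent k) ->
  (17 / 20 <= one_from m i)%R.
Proof.
move=> del k1 pH Hk loc; have mH := past_measurable pH.
have PHfin : P H \is a fin_num by exact: fin_num_measure.
set h := fine (P H); have PHE : P H = h%:E by rewrite fineK.
have mHE : measurable (H `&` recurrent k).
  by apply: measurableI => //; exact: measurable_recurrent.
have del0 : (0 < del)%R by rewrite /del; lra.
have delk0 : (0 < del ^+ k)%R by exact: exprn_gt0.
have delk : (del ^+ k <= del)%R.
  by rewrite -[leRHS]expr1; apply: ler_wiXn2l => //; rewrite /del; lra.
have PHE_le : P (H `&` recurrent k) <= h%:E.
  by rewrite -PHE; apply: le_measure; rewrite ?inE// => w [].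
have h0 : (0 < h)%R.
  move: (lt_le_trans loc PHE_le); rewrite PHE -EFinM lte_fin; nra.
move: loc; rewrite PHE -EFinM => /[dup] loc /(recurrent_visits (m + i) mH)[r vis].
(* The probability that a line started at time [m + i] is extinct at the horizon [m + i + r]. *)
set q := gf_comp (m + i) r 0.
have q01 : (0 <= q <= 1)%R by apply: gf_comp_itv; lra.
set s := ((1 + q) / 2)%R; have s01 : (0 <= s <= 1)%R by rewrite /s; lra.
have Fq01 : (0 <= gf_comp m i q <= 1)%R by exact: gf_comp_itv.
have Fs01 : (0 <= gf_comp m i s <= 1)%R by exact: gf_comp_itv.
(* Optional stopping from time [m + i], followed by a [k]-th root using [(1 - del) ^+ k <= 1 - del
   <= 1 - del ^+ k]. *)
have Fs : ((1 - del) / 2 <= gf_comp m i s)%R.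
  have pHi : past (m + i) H by move: pH; apply: past_le; rewrite leq_addr.
  have := visits_le X_law X_indep k r pHi.
  rewrite -/q -/s (integral_pw_gw X_law X_indep _ pH Hk s01) PHE.
  have PVfin : P (H `&` visits (X := X) k (m + i) r) \is a fin_num.
    by apply: fin_num_measure; apply: measurableI => //; exact: measurable_visits.
  move: vis; rewrite -(fineK PVfin) -!EFinM lte_fin lee_fin; set v := fine _ => vis visF.
  rewrite leNgt; apply/negP => Fs.
  have : (gf_comp m i s ^+ k <= (1 - del) ^+ k * (1 / 2) ^+ k)%R.
    rewrite -exprMn; apply: lerXn2r; rewrite ?nnegrE; last lra.
      by case/andP: Fs01.
    by rewrite /del; lra.
  have : ((1 - del) ^+ k <= 1 - del)%R.
    by rewrite -[leRHS]expr1; apply: ler_wiXn2l => //; rewrite /del; lra.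
  have two0 : (0 < (1 / 2 : R) ^+ k)%R by apply: exprn_gt0; lra.
  move: visF; set A := (gf_comp m i s ^+ k)%R; set B := ((1 - del) ^+ k)%R.
  set C := ((1 / 2) ^+ k)%R in two0 *; move=> visF Bd AB.
  have vC : (C * ((1 - del ^+ k) * h) < C * v)%R by rewrite ltr_pM2l.
  have hA : (h * A <= h * (B * C))%R by rewrite ler_pM2l.
  have BC : (h * (B * C) <= h * ((1 - del ^+ k) * C))%R.
    by rewrite ler_pM2l// ler_pM2r//; lra.
  by move: vC visF hA BC; clear; lra.
(* Extinction at the horizon rules out recurrence of [k >= 1], so within [H] it has probability
   below [del ^+ k * h]. *)
have Fq : (gf_comp m i q <= del)%R.
  have z01 : (0 <= (0 : R) <= 1)%R by lra.
  have := integral_pw_gw X_law X_indep (i + r) pH Hk z01.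
  rewrite gf_compD -/q PHE.
  have mZ : measurable (Z (m + (i + r)) @^-1` [set fin_state 0]) by exact: measurable_gw.
  (* Since [0 ^+ 0 = 1], [pw 0] is the indicator of state 0. *)
  have -> : \int[P]_(w in H) (pw 0 (Z (m + (i + r)) w))%:E =
      P (H `&` Z (m + (i + r)) @^-1` [set fin_state 0]).
    rewrite setIC -integral_indic//; apply: eq_integral => w _.
    rewrite indicE; congr EFin; case E: (Z _ w) => [[|j]|] /=.
    - by rewrite mem_set.
    - by rewrite memNset /= ?E// expr0n.
    - by rewrite memNset /= ?E.
  move=> PZ.
  have : P (H `&` Z (m + (i + r)) @^-1` [set fin_state 0]) <= P (H `\` recurrent k).
    apply: le_measure; rewrite ?inE.
    - exact: measurableI.
    - by apply: measurableD => //; exact: measurable_recurrent.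
    move=> w [Hw /= Z0]; split => // /(_ (m + (i + r))%N I)[j /= mj].
    by rewrite -(subnKC mj) (gw_absorb0 _ Z0) => -[k0]; rewrite -k0 in k1.
  have -> : P (H `\` recurrent k) = P H - P (H `&` recurrent k).
    apply: measureD => //; first exact: measurable_recurrent.
    by rewrite ltey_eq PHfin.
  have PEfin : P (H `&` recurrent k) \is a fin_num by exact: fin_num_measure.
  move: loc; rewrite PZ PHE -(fineK PEfin) -EFinB -EFinM lte_fin lee_fin => loc Zle.
  rewrite leNgt; apply/negP => Fq.
  have : (del ^+ k <= gf_comp m i q ^+ k)%R by apply: lerXn2r; rewrite ?nnegrE; lra.
  move: Zle loc h0; set A := (gf_comp m i q ^+ k)%R; clear; nra.
have mW := measurable_gw_from (X := X) m 1 i.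
have := egf_le (P := P) (a := 1%R) (b := (2 / 5)%R) (c := (1 / 10 - q / 2)%R) mW s01 q01.
rewrite !(egf_gw_from X_law X_indep)// !expr1 => gap.
have {}gap :
    (gf_comp m i s <= 1 * gf_comp m i q + 2 / 5 + (1 / 10 - q / 2) * one_from m i)%R.
  by apply: gap => z; have := pw_gap z q01; rewrite -/s; lra.
have one0 : (0 <= one_from m i)%R by exact: fine_ge0.
(* With [q >= 0] the three bounds give [one_from m i / 10 >= 1 / 10 - 3 * del / 2], which leaves
   room above 17/20. *)
by move: Fs Fq gap q01 one0; rewrite /del; nra.
Qed.

Lemma recurrent_summable k : (1 <= k)%N -> 0 < P (recurrent k) ->
  \sum_(1 <= n <oo) (1 - f n 1%N)%:E < +oo.
Proof.
move=> k1 Pk; set F := fun n => Z n @^-1` [set fin_state k].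
have mF n : measurable (F n) by exact: measurable_gw.
set del : R := (1 / 200)%R.
have e01 : (0 < del ^+ k < 1)%R.
  by rewrite exprn_gt0 ?exprn_ilt1//= -?lt0n//; rewrite /del; lra.
have [M [i loc]] := lim_sup_set_localize mF e01 Pk.
set H := seqDU _ _ in loc.
(* [H] is the event of a first visit, counted from time [M], at time [M + i]; it depends on the
   first [M + i] generations only. *)
have pH : past (M + i) H.
  apply: history_setD; first exact: past_gw.
  apply: (big_ind (past (M + i))) => [||j _].
  - exact: history_set0.
  - by move=> A B; exact: history_setU.
  - by apply: past_le (past_gw _); rewrite leq_add2l ltnW.
have Hk : H `<=` Z (M + i) @^-1` [set fin_state k] by move=> w [].
have one r := one_from_recurrent r k1 pH Hk loc.
apply: (nneseries_bounded_sum (m := (M + i)%N) (C := 1%R)).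
  by move=> n n1; have := offspring1_le1 X_law n1; lra.
by move=> j; apply: (sum_offspring1 X_law X_indep).
Qed.

End recurrence.

(** * The limit *)

(** The default of [xget] sends every sequence that is not eventually constant to infinity, so the
    limit is defined everywhere. *)
Definition eventual_value (z : nat -> NDelta) : NDeltaInf :=
  xget at_infty [set at_state a | a in [set a | \forall n \near \oo, z n = a]].

Lemma eventual_valueP z a :
  (\forall n \near \oo, z n = a) <-> eventual_value z = at_state a.
Proof.
split=> [za|]; last first.
  rewrite /eventual_value; case: xgetP => [l _ [b zb <-] [<-]|_]; by [].
apply: xget_subset1; first by exists a.
move=> _ _ [b zb <-] [c zc <-]; congr at_state.
by have [N _ /(_ N (leqnn N))[/= -> ->]] := filterI zb zc.
Qed.

Section limit.
Context {R : realType} {d : measure_display} {T : measurableType d}.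
Context {P : probability T R} (X : nat -> nat -> {RV P >-> NDelta}).

Local Notation Z := (gw_process X).
Local Notation recurrent k := (lim_sup_set (fun n => Z n @^-1` [set fin_state k])).

Definition gw_limit (w : T) : NDeltaInf := eventual_value (fun n => Z n w).

Lemma measurable_gw_limit_state a : measurable (gw_limit @^-1` [set at_state a]).
Proof.
rewrite (_ : _ @^-1` _ =
  \bigcup_N \bigcap_(n in [set n | (N <= n)%N]) (Z n @^-1` [set a])).
  apply: bigcupT_measurable => N; apply: bigcap_measurable; first by exists N => /=.
  by move=> n _; exact: measurable_gw.
apply/seteqP; split => [w /eventual_valueP[N _ ZN]|w [N _ ZN]].
  by exists N => // n /= /ZN.
by apply/eventual_valueP; exists N => // n /ZN.
Qed.

Lemma measurable_gw_limit : measurable_fun setT gw_limit.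
Proof.
move=> _ B _; rewrite setTI; apply: preimage_countable => //.
  by move=> F mF; exact: bigcupT_measurable.
move=> [a|]; first exact: measurable_gw_limit_state.
rewrite (_ : _ @^-1` _ = ~` (gw_limit @^-1` [set at_state graveyard] `|`
  \bigcup_k gw_limit @^-1` [set at_state (fin_state k)])).
  apply: measurableC; apply: measurableU; first exact: measurable_gw_limit_state.
  by apply: bigcupT_measurable => k; exact: measurable_gw_limit_state.
apply/seteqP; split => [w /= Zw [|[k _]]|w nw]; rewrite /= ?Zw//.
case E: (gw_limit w) => [[k|]|//].
  by case: nw; right; exists k.
by case: nw; left.
Qed.

HB.instance Definition _ := isMeasurableFun.Build _ _ _ _ gw_limit measurable_gw_limit.

(** A path without eventual value avoids the absorbing states. By induction on [M] it finally stays
    at or above [M], since infinitely many visits to a positive state would force an eventual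
    value. *)
Lemma cvg_gw_limit w :
  (forall k, (1 <= k)%N -> recurrent k w -> gw_limit w = at_state (fin_state k)) ->
  cvg_NDelta (fun n => Z n w) (gw_limit w).
Proof.
move=> rec; case E: (gw_limit w) => [a|] /=; first exact/eventual_valueP.
have neq a : gw_limit w <> at_state a by rewrite E.
have Zpos n : Z n w <> graveyard /\ Z n w <> fin_state 0.
  split=> Zn; [apply: (neq graveyard)|apply: (neq (fin_state 0))];
    apply/eventual_valueP; exists n => // m /= nm; rewrite -(subnKC nm).
    exact: gw_absorbD.
  exact: gw_absorb0.
elim=> [|M [N _ IH]].
  exists 0%N => // n _ /=; have [ng _] := Zpos n.
  by case E': (Z n w) ng => [k|] // _; exists k.
have [[N' ZN']|nrec] :=
    pselect (exists N', forall n, (N' <= n)%N -> Z n w <> fin_state M).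
  exists (maxn N N') => // n; rewrite /= geq_max => /andP[/IH[k Zk Mk] /ZN'] ZM.
  by exists k => //; rewrite ltn_neqAle Mk andbT; apply/eqP => kM; rewrite kM in ZM.
case: M IH nrec => [|M] IH nrec.
  exists 0%N => // n _ /=; have [ng n0] := Zpos n.
  by case E': (Z n w) ng n0 => [[|k]|] // _ _; exists k.+1.
exfalso; apply: (neq (fin_state M.+1)); apply: rec => // n _.
by apply: contrapT => nZ; apply: nrec; exists n => j nj Zj; apply: nZ; exists j.
Qed.

End limit.

(** * Consequences of a summable series *)

Section summable.
Context {R : realType} {d : measure_display} {T : measurableType d}.
Context {P : probability T R} {f : nat -> nat -> R}.
Context {X : nat -> nat -> {RV P >-> NDelta}}.
Context (X_law : forall n j, (1 <= n)%N -> (1 <= j)%N -> has_law (X n j) (f n)).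
Context (X_indep : mutually_independent
       [set i : nat * nat | (1 <= i.1)%N && (1 <= i.2)%N]
       (fun i => X i.1 i.2)).

Local Notation past n := (past (X := X) n 0).
Local Notation Z := (gw_process X).
Local Notation recurrent k := (lim_sup_set (fun n => Z n @^-1` [set fin_state k])).

(** Both indices are shifted: this concerns individual [j + 1] of generation [n + 1]. Time comes
    last, so that [not_single j] is a sequence of events for Borel-Cantelli. *)
Definition not_single j n : set T := ~` (X n.+1 j.+1 @^-1` [set fin_state 1]).

Lemma measurable_not_single j n : measurable (not_single j n).
Proof. by apply: measurableC; exact: measurable_RV_preimage. Qed.

Lemma prob_not_single j n : P (not_single j n) = (1 - f n.+1 1%N)%:E.
Proof.
rewrite /not_single probability_setC; last exact: measurable_RV_preimage.
by rewrite (proj1 (X_law (ltn0Sn n) (ltn0Sn j))).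
Qed.

Lemma gw_single n k w : Z n w = fin_state k ->
  (forall j, (j < k)%N -> ~ not_single j n w) ->
  Z n.+1 w = fin_state k.
Proof.
move=> Zn single /=; rewrite Zn -[k in RHS]muln1; apply: sumD_cst => -[//|j] /andP[_ jk].
by apply: contrapT => Xj; exact: (single j).
Qed.

Lemma gw_single_from N k w : Z N w = fin_state k ->
  (forall n j, (N <= n)%N -> (j < k)%N -> ~ not_single j n w) ->
  gw_limit X w = at_state (fin_state k).
Proof.
move=> ZN single; apply/eventual_valueP; exists N => // n /= Nn.
rewrite -(subnKC Nn); elim: (n - N)%N => [|l IH]; first by rewrite addn0.
by rewrite addnS; apply: gw_single => // j jk; apply: single; rewrite ?leq_addr.
Qed.

Context (f_summable : \sum_(1 <= n <oo) (1 - f n 1%N)%:E < +oo).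

Lemma nneseries_not_single : \sum_(0 <= n <oo) (1 - f n.+1 1%N)%:E < +oo.
Proof.
pose a n : \bar R := if n is n'.+1 then (1 - f n'.+1 1%N)%:E else 0.
have a0 n : 0 <= a n.
  case: n => [//|n] /=; rewrite lee_fin subr_ge0.
  exact: (offspring1_le1 X_law).
have : \sum_(i <oo) a (i + 1)%N < +oo.
  rewrite nneseries_addn//; apply: le_lt_trans f_summable.
  rewrite eseries_cond [leRHS]eseries_cond.
  by rewrite (@eq_eseriesr _ _ (fun n => (1 - f n 1%N)%:E))// => -[].
by under eq_eseriesr do rewrite addn1.
Qed.

Lemma tail_not_single (e : R) : (0 < e)%R ->
  exists N, forall M, (N <= M)%N -> \sum_(M <= n <oo) (1 - f n.+1 1%N)%:E < e%:E.
Proof.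
move=> e0.
have a0 n : 0 <= (1 - f n.+1 1%N)%:E.
  by rewrite lee_fin subr_ge0; exact: (offspring1_le1 X_law).
have /fine_cvgP[[N1 _ fin] /cvgrPdist_lt/(_ e e0)[N2 _ small]] :
    \sum_(M <= n <oo) (1 - f n.+1 1%N)%:E @[M --> \oo] --> (0%R : R)%:E.
  by apply: (nneseries_tail_cvg (P := xpredT)) => //; exact: nneseries_not_single.
exists (maxn N1 N2) => M; rewrite geq_max => /andP[/fin Mfin /small].
rewrite /= sub0r normrN => M2; rewrite -(fineK Mfin) lte_fin.
exact: le_lt_trans (ler_norm _) M2.
Qed.

Lemma not_single_finitely_often j : P (lim_sup_set (not_single j)) = 0.
Proof.
apply: lim_sup_set_cvg0; first exact: measurable_not_single.
rewrite (eq_eseriesr (g := fun n => (1 - f n.+1 1%N)%:E)).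
  exact: nneseries_not_single.
by move=> n _; exact: prob_not_single.
Qed.

(** From some time on the first [k] individuals always have one child each, so the next visit to [k]
    is never left. *)
Lemma single_recurrent w : (forall j, ~ lim_sup_set (not_single j) w) ->
  forall k, recurrent k w -> gw_limit X w = at_state (fin_state k).
Proof.
move=> single k rec.
have [N HN] : exists N, forall n j, (N <= n)%N -> (j < k)%N -> ~ not_single j n w.
  elim: k {rec} => [|k [N IH]]; first by exists 0%N.
  have := single k; rewrite /lim_sup_set => /existsNP[N' /not_implyP[_ HN']].
  exists (maxn N N') => n j; rewrite geq_max => /andP[Nn N'n].
  rewrite ltnS leq_eqVlt => /predU1P[->|jk]; last exact: IH.
  by move=> bad; apply: HN'; exists n.
have [n /= Nn Zn] := rec N I.
by apply: (gw_single_from Zn) => m j nm; apply: HN; exact: leq_trans nm.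
Qed.

End summable.

(** * Positive probability of a positive finite limit *)

Section positivity.
Context {R : realType} {d : measure_display} {T : measurableType d}.
Context {P : probability T R} {f : nat -> nat -> R}.
Context {X : nat -> nat -> {RV P >-> NDelta}}.
Context (f_distr : forall n, (1 <= n)%N -> defective_distribution (f n)).
Context (f_mean : forall n, (1 <= n)%N -> 0 < dgenfun1 (f n) < +oo).
Context (X_law : forall n j, (1 <= n)%N -> (1 <= j)%N -> has_law (X n j) (f n)).
Context (X_indep : mutually_independent
       [set i : nat * nat | (1 <= i.1)%N && (1 <= i.2)%N]
       (fun i => X i.1 i.2)).

Local Notation past n a := (past (X := X) n a).
Local Notation Z := (gw_process X).

Lemma offspring_indep n a H (B : set NDelta) : past n a H ->
  P (H `&` X n.+1 a.+1 @^-1` B) = P H * P (X n.+1 a.+1 @^-1` B).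
Proof.
move=> hH; apply: (history_indep X_indep (@born_sub n a) (i := (n.+1, a.+1))) => //.
by rewrite /born /=; lia.
Qed.

(** All [k] individuals may have exactly [b] children; independence adds them one at a time as the
    set [S a]. *)
Lemma gw_step_gt0 n k b : (0 < f n.+1 b)%R ->
  0 < P (Z n @^-1` [set fin_state k]) ->
  0 < P (Z n.+1 @^-1` [set fin_state (k * b)]).
Proof.
move=> fb; set H := Z n @^-1` [set fin_state k] => PH.
pose S a : set T := [set w | forall j, (1 <= j <= a)%N -> X n.+1 j w = fin_state b].
have SS a : S a.+1 = S a `&` X n.+1 a.+1 @^-1` [set fin_state b].
  apply/seteqP; split => [w Sw|w [Sw Xw] j /andP[j1]].
    by split=> [j ja|]; apply: Sw; lia.
  by rewrite leq_eqVlt => /predU1P[->//|ja]; apply: Sw; rewrite j1.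
have /(_ k)[hS PS] a : past n a (H `&` S a) /\ 0 < P (H `&` S a).
  elim: a => [|a [hS PS]].
    have -> : S 0%N = setT by apply/seteqP; split => // w _ j; lia.
    by rewrite setIT; split => //; apply: past_widen; exact: past_gw.
  rewrite SS setIA; split.
    apply: history_setI; last exact: past_offspring.
    move: hS; apply: past_subset => -[u v]; rewrite /born /=; lia.
  rewrite offspring_indep// (proj1 (X_law (ltn0Sn n) (ltn0Sn a))).
  by rewrite mule_gt0.
apply: (lt_le_trans PS); apply: le_measure; rewrite ?inE.
- exact: past_measurable hS.
- exact: measurable_gw.
- by move=> w [/= -> Sw]; exact: sumD_cst.
Qed.

Lemma offspring_pos n : exists2 b, (1 <= b)%N & (0 < f n.+1 b)%R.
Proof.
apply: contrapT => nb; have [f0 _] := f_distr (ltn0Sn n).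
have /andP[+ _] := f_mean (ltn0Sn n); rewrite /dgenfun1 eseries0 ?ltxx// => b _ _.
case: b => [|b]; first by rewrite mul0r.
rewrite (_ : f n.+1 b.+1 = 0%R) ?mulr0//; apply/eqP.
by rewrite eq_le f0 andbT leNgt; apply/negP => fb; apply: nb; exists b.+1.
Qed.

Lemma gw_pos n : exists2 k, (1 <= k)%N & 0 < P (Z n @^-1` [set fin_state k]).
Proof.
elim: n => [|n [k k1 Pk]].
  exists 1%N => //; rewrite (_ : _ @^-1` _ = setT) ?probability_setT ?lte01//.
  exact/seteqP.
have [b b1 fb] := offspring_pos n.
by exists (k * b)%N; [rewrite muln_gt0 k1|exact: gw_step_gt0].
Qed.

(** Reach some [k >= 1], hold it until the tail of the series is below [1 / (k + 1)], then apply a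
    union bound over [k] individuals and all later generations. *)
Lemma gw_limit_pos : \sum_(1 <= n <oo) (1 - f n 1%N)%:E < +oo ->
  exists2 k, (1 <= k)%N & 0 < P (gw_limit X @^-1` [set at_state (fin_state k)]).
Proof.
move=> f_sum; have tail := tail_not_single X_law f_sum.
have a0 n : 0 <= (1 - f n.+1 1%N)%:E.
  by rewrite lee_fin subr_ge0; exact: (offspring1_le1 X_law).
have [N1 HN1] := tail 1%R ltr01.
have f1 n : (N1 <= n)%N -> (0 < f n.+1 1%N)%R.
  move=> /HN1; rewrite (@nneseries_split _ _ n 1%N)// => lt1.
  have : (1 - f n.+1 1%N)%:E < 1%:E.
    apply: le_lt_trans lt1; rewrite addn1 big_nat1 leeDl//.
    exact: nneseries_ge0.
  by rewrite lte_fin; lra.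
have [k k1 Pk] := gw_pos N1; exists k => //.
have k0 : (0 < k%:R + 1 :> R)%R by rewrite ltr_wpDl.
have kV0 : (0 < (k%:R + 1)^-1 :> R)%R by rewrite invr_gt0.
have [N2 HN2] := tail _ kV0.
set N := maxn N1 N2; have {HN2}HN := HN2 N (leq_maxr _ _).
(* [N2] depends on [k], which was fixed at time [N1]. From [N1] on one child has positive
   probability, so [k] can be held until [N]. *)
have {Pk}Pk : 0 < P (Z N @^-1` [set fin_state k]).
  rewrite -(subnKC (leq_maxl N1 N2 : (N1 <= N)%N)); elim: (N - N1)%N => [|l IH].
    by rewrite addn0.
  rewrite addnS -[k in fin_state k]muln1.
  by apply: gw_step_gt0 => //; rewrite f1 ?leq_addr.
set H := Z N @^-1` [set fin_state k] in Pk.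
have mH : measurable H by exact: measurable_gw.
have PHfin : P H \is a fin_num by exact: fin_num_measure.
(* Intersecting with [H] and using independence from the past keeps the factor [P H] in every
   bound. *)
pose F j := \bigcup_(n in ~` `I_N) (H `&` not_single (X := X) j n).
have mF j : measurable (F j).
  apply: bigcup_measurable => n _; apply: measurableI => //.
  exact: measurable_not_single.
have PF j : P (F j) <= P H * (k%:R + 1)^-1%:E.
  apply: (@le_trans _ _ (\sum_(N <= n <oo) P (H `&` not_single (X := X) j n))).
    apply: measure_sigma_subadditive_tail => // n; apply: measurableI => //.
    exact: measurable_not_single.
  apply: (@le_trans _ _ (P H * \sum_(N <= n <oo) (1 - f n.+1 1%N)%:E)); last first.
    by apply: lee_wpmul2l; [exact: measure_ge0|exact: ltW].
  rewrite -(fineK PHfin) -nneseriesZl// fineK// eseries_cond [leRHS]eseries_cond.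
  apply: lee_nneseries => [n _ _|n /= Nn]; first exact: measure_ge0.
  rewrite -(prob_not_single X_law j n) /not_single preimage_setC offspring_indep//.
  by apply: past_widen; move: (past_gw (X := X) (n := N) (fin_state k)); apply: past_le.
set U := \big[setU/set0]_(j < k) F j.
have mU : measurable U by apply: bigsetU_measurable => j _; exact: mF.
(* The [k] bounds add up to [k / (k + 1)] times [P H]. *)
have PU : P U < P H.
  apply: (@le_lt_trans _ _ (\sum_(j < k) P (F j))).
    by apply: Boole_inequality => j _; exact: mF.
  apply: (@le_lt_trans _ _ (\sum_(j < k) P H * (k%:R + 1)^-1%:E)).
    by apply: lee_sum => j _; exact: PF.
  rewrite -(fineK PHfin) sumEFin lte_fin sumr_const card_ord -[ltLHS]mulr_natr.
  have h0 : (0 < fine (P H))%R by rewrite fine_gt0// Pk ltey_eq PHfin.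
  rewrite -mulrA gtr_pMr// mulrC ltr_pdivrMr// mul1r ltrDl; exact: ltr01.
have PHU : 0 < P (H `\` U).
  have -> : P (H `\` U) = P H - P (H `&` U).
    by apply: measureD => //; rewrite ltey_eq PHfin.
  rewrite sube_gt0; apply: le_lt_trans PU; apply: le_measure; rewrite ?inE//.
  exact: measurableI.
apply: (lt_le_trans PHU); apply: le_measure; rewrite ?inE.
- exact: measurableD.
- exact: measurable_gw_limit_state.
move=> w [Hw nU]; apply: (gw_single_from Hw) => n j Nn jk bad; apply: nU.
rewrite /U -bigcup_mkord; exists j => //; exists n => //=.
by apply/negP; rewrite -leqNgt.
Qed.

End positivity.

Theorem theorem1 (R : realType) (d : measure_display) (T : measurableType d)
    (P : probability T R) (f : nat -> nat -> R)
    (X : nat -> nat -> {RV P >-> NDelta})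
    (f_distr : forall n, (1 <= n)%N -> defective_distribution (f n))
    (f_mean : forall n, (1 <= n)%N -> 0 < dgenfun1 (f n) < +oo)
    (X_law : forall n j, (1 <= n)%N -> (1 <= j)%N -> has_law (X n j) (f n))
    (X_indep : mutually_independent
       [set i : nat * nat | (1 <= i.1)%N && (1 <= i.2)%N]
       (fun i => X i.1 i.2)) :
  exists Zinf : {RV P >-> NDeltaInf},
    {ae P, forall w, cvg_NDelta (fun n => gw_process X n w) (Zinf w)} /\
    (0 < P [set w | exists2 k, (0 < k)%N & Zinf w = at_state (fin_state k)] <->
     \sum_(1 <= n <oo) (1 - f n 1%N)%:E < +oo).
Proof.
exists (gw_limit X).
set recurrent := fun k => lim_sup_set (fun n => gw_process X n @^-1` [set fin_state k]).
have mZ : measurable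
    [set w | exists2 k, (0 < k)%N & gw_limit X w = at_state (fin_state k)].
  have := measurable_gw_limit X measurableT
    (Y := [set l | exists2 k, (0 < k)%N & l = at_state (fin_state k)]).
  by rewrite setTI; apply.
(* The split is on recurrence of a positive state: if one exists both sides of the equivalence hold,
   otherwise both fail. *)
have [[k k1 Pk]|null] := pselect (exists2 k, (1 <= k)%N & 0 < P (recurrent k)).
  have f_sum := recurrent_summable X_law X_indep k1 Pk.
  split.
    have : P.-negligible (\bigcup_j lim_sup_set (not_single (X := X) j)).
      apply: negligible_bigcup => j; apply/negligibleP.
        apply: bigcap_measurable; first by exists 0%N.
        by move=> n _; apply: bigcup_measurable => i _; exact: measurable_not_single.
      exact: (not_single_finitely_often X_law f_sum).
    apply: negligibleS => w ncvg; apply: contrapT => single; apply: ncvg => /=.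
    apply: cvg_gw_limit => l l1; apply: single_recurrent => j bad.
    by apply: single; exists j.
  split=> // _; have [l l1 Pl] := gw_limit_pos f_distr f_mean X_law X_indep f_sum.
  apply: (lt_le_trans Pl); apply: le_measure; rewrite ?inE.
  - exact: measurable_gw_limit_state.
  - exact: mZ.
  - by move=> w; exists l.
have rec0 k : P.-negligible (recurrent k.+1).
  apply/negligibleP; first exact: measurable_recurrent.
  apply/eqP; rewrite -measure_le0 leNgt; apply/negP => Pk; apply: null.
  by exists k.+1.
have rec : P.-negligible (\bigcup_k recurrent k.+1) by exact: negligible_bigcup.
split.
  apply: negligibleS rec => w ncvg; apply: contrapT => nrec; apply: ncvg => /=.
  by apply: cvg_gw_limit => -[//|k] _ Zk; exfalso; apply: nrec; exists k.
split=> [|f_sum].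
  suff -> : P [set w | exists2 k, (0 < k)%N & gw_limit X w = at_state (fin_state k)] = 0.
    by rewrite ltxx.
  apply/negligibleP; first exact: mZ.
  apply: negligibleS rec => w [[//|k] _ /eventual_valueP[N _ ZN]].
  exists k => // n _; exists (maxn n N); first by rewrite /= leq_maxl.
  by apply: ZN; rewrite /= leq_maxr.
(* A summable series would produce a limit [l >= 1] with positive probability, making [l]
   recurrent. *)
have [l l1 Pl] := gw_limit_pos f_distr f_mean X_law X_indep f_sum.
exfalso; apply: null; exists l => //; apply: (lt_le_trans Pl).
apply: le_measure; rewrite ?inE.
- exact: measurable_gw_limit_state.
- exact: measurable_recurrent.
move=> w /eventual_valueP[N _ ZN] n _; exists (maxn n N); first by rewrite /= leq_maxl.
by apply: ZN; rewrite /= leq_maxr.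
Qed.
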